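(* Let $m>0$. Let $\sigma\in M^{2m}_{\rho,\Lambda}(\mathbb{Z}\times\mathbb{T})$ be elliptic and such that $\sigma(k,x)\ge0$ for all $x\in\mathbb{T}$ and co-finitely many $k\in\mathbb{Z}$. Then there exist $C_0,C_1>0$ such that for all $f\in\ell^2_{m,\Lambda}(\mathbb{Z})$, $$\operatorname{Re}(T_\sigma f,f)_{\ell^2(\mathbb{Z})}\ge C_0\|f\|^2_{\ell^2_{m,\Lambda}(\mathbb{Z})}-C_1\|f\|^2_{\ell^2(\mathbb{Z})}.$$
   Context: $\mathbb{N}_0=\{0,1,2,\dots\}$, and $\mathbb{T}=\mathbb{R}/2\pi\mathbb{Z}$ is the one-dimensional torus. For a function $a$ of $k\in\mathbb{Z}$, $\Delta_k a(k)=a(k+1)-a(k)$ and $\Delta_k^\alpha$ is its $\alpha$-th iterate. ''Co-finitely many $k$'' means all but finitely many $k$. Weight function: $\Lambda:\mathbb{Z}\to(0,\infty)$ is a fixed function for which there are positive constants $\mu_0\le\mu_1$, $c_0,c_1$ with $c_0(1+|k|)^{\mu_0}\le\Lambda(k)\le c_1(1+|k|)^{\mu_1}$ for all $k\in\mathbb{Z}$. Moreover there is a real constant $\mu\ge\mu_1$ such that for all $\alpha\in\mathbb{N}_0$ and $\gamma\in\{0,1\}$ there is $C_{\alpha,\gamma}>0$ with $|k^\gamma\Delta_k^{\alpha+\gamma}\Lambda(k)|\le C_{\alpha,\gamma}\Lambda(k)^{1-\alpha/\mu}$ for all $k\in\mathbb{Z}$. Fix $\rho\in(0,1/\mu]$.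 Symbol class: for $r\in\mathbb{R}$, $M^r_{\rho,\Lambda}(\mathbb{Z}\times\mathbb{T})$ is the set of functions $\sigma:\mathbb{Z}\times\mathbb{T}\to\mathbb{C}$, smooth in $x\in\mathbb{T}$ for every $k\in\mathbb{Z}$, such that for all $\alpha,\beta\in\mathbb{N}_0$ and $\gamma\in\{0,1\}$ there is $C_{\alpha,\beta,\gamma}>0$ with $|\Delta_k^\alpha\partial_x^\beta\big(k^\gamma\Delta_k^\gamma\sigma(k,x)\big)|\le C_{\alpha,\beta,\gamma}\Lambda(k)^{r-\rho\alpha}$ for all $(k,x)\in\mathbb{Z}\times\mathbb{T}$. Such a $\sigma$ is ($M$-)elliptic of order $r$ if there are positive constants $C,R$ with $|\sigma(k,x)|\ge C\Lambda(k)^r$ for all $x\in\mathbb{T}$ and all $k\in\mathbb{Z}$ with $|k|\ge R$; here $r=2m$. The pseudo-differential operator on $\mathbb{Z}$ with symbol $\sigma$ is $T_\sigma f(k)=(2\pi)^{-1}\int_{-\pi}^{\pi}e^{ikx}\sigma(k,x)\widehat f(x)\,dx$ with $\widehat f(x)=\sum_{l\in\mathbb{Z}}f(l)e^{-ilx}$; equivalently $T_\sigma f(k)=\sum_{l\in\mathbb{Z}}f(l)\,(2\pi)^{-1}\int_{-\pi}^{\pi}e^{i(k-l)x}\sigma(k,x)\,dx$. For $s\in\mathbb{R}$, $\ell^2_{s,\Lambda}(\mathbb{Z})$ is the space of all $f:\mathbb{Z}\to\mathbb{C}$ with $\|f\|_{\ell^2_{s,\Lambda}(\mathbb{Z})}:=\big(\sum_{k\in\mathbb{Z}}\Lambda(k)^{2s}|f(k)|^2\big)^{1/2}<\infty$.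 The form $(g,f)_{\ell^2(\mathbb{Z})}=\sum_{k\in\mathbb{Z}}g(k)\overline{f(k)}$ is understood for $g\in\ell^2_{-m,\Lambda}(\mathbb{Z})$, $f\in\ell^2_{m,\Lambda}(\mathbb{Z})$ (duality pairing). *)

(* Defs.v *)
From Stdlib Require Import Reals ZArith List.
From Coquelicot Require Import Coquelicot.
Open Scope R_scope.

Definition Delta {G : AbelianGroup} (a : Z -> G) (k : Z) : G :=
  minus (a (k + 1)%Z) (a k).

Definition Delta_n {G : AbelianGroup} (n : nat) (a : Z -> G) : Z -> G :=
  Nat.iter n Delta a.

(* A sum over Z is split into the sums over k >= 0 and over k < 0.  [sumZ] has
   no meaning when one of the two halves diverges. *)
Definition ex_sumZ (a : Z -> R) : Prop :=
  ex_series (fun n : nat => a (Z.of_nat n)) /\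
  ex_series (fun n : nat => a (- Z.of_nat (S n))%Z).

Definition sumZ (a : Z -> R) : R :=
  Series (fun n : nat => a (Z.of_nat n)) +
  Series (fun n : nat => a (- Z.of_nat (S n))%Z).

Definition CsumZ (a : Z -> C) : C :=
  (sumZ (fun k => Re (a k)), sumZ (fun k => Im (a k))).

Definition Csmooth (g : R -> C) : Prop :=
  forall (n : nat) (x : R),
    ex_derive_n (fun y => Re (g y)) n x /\ ex_derive_n (fun y => Im (g y)) n x.

Definition CDerive_n (g : R -> C) (n : nat) (x : R) : C :=
  (Derive_n (fun y => Re (g y)) n x, Derive_n (fun y => Im (g y)) n x).

Definition Cis (x : R) : C := (cos x, sin x).

Definition weight_function (Lambda : Z -> R) (mu : R) : Prop :=
  (forall k : Z, 0 < Lambda k) /\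
  (exists mu0 mu1 c0 c1 : R,
     0 < mu0 /\ mu0 <= mu1 /\ 0 < c0 /\ 0 < c1 /\ mu1 <= mu /\
     forall k : Z,
       c0 * Rpower (1 + Rabs (IZR k)) mu0 <= Lambda k /\
       Lambda k <= c1 * Rpower (1 + Rabs (IZR k)) mu1) /\
  (forall alpha gamma : nat, gamma = 0%nat \/ gamma = 1%nat ->
     exists K : R, 0 < K /\
       forall k : Z,
         Rabs (IZR k ^ gamma * Delta_n (alpha + gamma) Lambda k)
         <= K * Rpower (Lambda k) (1 - INR alpha / mu)).

(* A function on Z x T is a function on Z x R that is 2 pi-periodic in its
   second variable. *)
Definition symbol_class (rho : R) (Lambda : Z -> R) (r : R)
    (sigma : Z -> R -> C) : Prop :=
  (forall (k : Z) (x : R), sigma k (x + 2 * PI) = sigma k x) /\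
  (forall k : Z, Csmooth (sigma k)) /\
  (forall alpha beta gamma : nat, gamma = 0%nat \/ gamma = 1%nat ->
     exists K : R, 0 < K /\
       forall (k : Z) (x : R),
         Cmod
           (Delta_n alpha
              (fun j : Z =>
                 CDerive_n
                   (fun y : R =>
                      (RtoC (IZR j ^ gamma)
                       * Delta_n gamma (fun i : Z => sigma i y) j)%C)
                   beta x)
              k)
         <= K * Rpower (Lambda k) (r - rho * INR alpha)).

Definition M_elliptic (Lambda : Z -> R) (r : R) (sigma : Z -> R -> C) : Prop :=
  exists K N : R, 0 < K /\ 0 < N /\
    forall (k : Z) (x : R),
      N <= Rabs (IZR k) -> K * Rpower (Lambda k) r <= Cmod (sigma k x).

Definition cofinitely_many (P : Z -> Prop) : Prop :=
  exists l : list Z, forall k : Z, ~ In k l -> P k.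

Definition Cnonneg (z : C) : Prop := Im z = 0 /\ 0 <= Re z.

(* The inner sum over l defining T_sigma f (k) in terms of the Fourier
   coefficients of sigma(k, .); for a symbol of class M and f of polynomial
   growth it converges absolutely, so no L^2 extension of the Fourier transform
   of f is involved. *)
Definition T_op (sigma : Z -> R -> C) (f : Z -> C) (k : Z) : C :=
  CsumZ (fun l : Z =>
    (f l * (RtoC (/ (2 * PI))
            * @RInt C_R_CompleteNormedModule
                (fun x : R => Cis (IZR (k - l) * x) * sigma k x)
                (- PI) PI))%C).

Definition in_l2w (Lambda : Z -> R) (s : R) (f : Z -> C) : Prop :=
  ex_sumZ (fun k => Rpower (Lambda k) (2 * s) * Cmod (f k) ^ 2).

Definition l2w_norm (Lambda : Z -> R) (s : R) (f : Z -> C) : R :=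
  sqrt (sumZ (fun k => Rpower (Lambda k) (2 * s) * Cmod (f k) ^ 2)).

Definition l2_norm (f : Z -> C) : R :=
  sqrt (sumZ (fun k => Cmod (f k) ^ 2)).

Definition l2_pairing (g f : Z -> C) : C :=
  CsumZ (fun k => (g k * Cconj (f k))%C).

(* Main.v *)
Require Import Defs.
From Stdlib Require Import Reals ZArith List Lra Lia.
From Coquelicot Require Import Coquelicot.
Open Scope R_scope.

(** The matrix of [T_sigma] has the entries [A k l], the mean over the circle of
    [e^(i(k-l)x) sigma_k(x)], and Garding's inequality is a lower bound for the
    real part of the form [sum f_l conj(f_k) A k l].  Outside a bounded set of
    indices the symbol is real and at least [kappa Lambda^(2m)], so it splits as
    [sigma_k = a_k + d_k], where [d_k = c sigma_k(0)] does not depend on [x] and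
    both parts are at least a multiple of [Lambda_k^(2m)].  Put
    [b_k = sqrt a_k].  No operator calculus is needed, only the identity
      [sigma_k + sigma_l = 2 b_k b_l + (b_k - b_l)^2 + d_k + d_l]
    inserted in the form symmetrised in [k] and [l]:
    - the kernel [b_k b_l] contributes the mean of the squared modulus of
      [sum f_k e^(-ikx) b_k(x)], which is nonnegative ([square_form_nonneg]);
    - [d] is independent of [x], so it only contributes on the diagonal, where
      it gives a multiple of the norm of order [m];
    - [(b_k - b_l)^2] is an error of lower order ([root_difference]).

    For the error, one difference in [k] gains the factor [Lambda^(-rho)], at the
    price of a power of [1 + |k - l|].  Every power of [1 + |k - l|] can be paid
    for, because smoothness in [x] makes Fourier coefficients at frequency
    [k - l] decay as fast as desired ([Fourier_decay]); this includes the power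
    that Peetre's inequality ([weight_Peetre]) charges for replacing [Lambda_k]
    by [Lambda_l].  The entries of the error are thus at most a constant times
    [Lambda_k^(m-rho) Lambda_l^(m-rho) / (1 + |k - l|)^2], and so are the entries
    with an index in the bounded set ([form_bad]).  Schur's test ([SZ_schur])
    bounds their sum by the squared norm of order [m - rho], which is at most
    [eps] times the squared norm of order [m] plus a multiple of the [l2] norm
    ([weight_absorb]).

    All this is done for sums over finite squares of indices
    ([form_lower_bound]); the same Schur estimate makes the double series
    absolutely convergent, and the inequality passes to the limit
    ([pairing_lim]). *)

(** * Symmetric partial sums over the integers *)

(** Growing by one index at each end, instead of summing over a shifted range of
    natural numbers, makes the facts below plain inductions. *)
Fixpoint SZ (N : nat) (a : Z -> R) : R :=
  match N with
  | O => 0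
  | S p => SZ p a + (a (Z.of_nat p) + a (- Z.of_nat (S p))%Z)
  end.

Lemma SZ_ext N a b : (forall k, a k = b k) -> SZ N a = SZ N b.
Proof. intros H; induction N; simpl; auto. rewrite IHN, !H; auto. Qed.

Lemma SZ_le N a b : (forall k, a k <= b k) -> SZ N a <= SZ N b.
Proof.
  intros H; induction N as [|N IH]; cbn [SZ]; try lra.
  generalize (H (Z.of_nat N)) (H (- Z.of_nat (S N))%Z); lra.
Qed.

Lemma SZ_plus N a b : SZ N (fun k => a k + b k) = SZ N a + SZ N b.
Proof. induction N; cbn [SZ]; lra. Qed.

Lemma SZ_scal N c a : SZ N (fun k => c * a k) = c * SZ N a.
Proof. induction N; cbn [SZ]; lra. Qed.

Lemma SZ_minus N a b : SZ N (fun k => a k - b k) = SZ N a - SZ N b.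
Proof. induction N; cbn [SZ]; lra. Qed.

Lemma SZ_zero N : SZ N (fun _ => 0) = 0.
Proof. induction N; cbn [SZ]; lra. Qed.

Lemma SZ_nonneg N a : (forall k, 0 <= a k) -> 0 <= SZ N a.
Proof. intros H; rewrite <- (SZ_zero N); apply SZ_le; auto. Qed.

Lemma SZ_abs N a : Rabs (SZ N a) <= SZ N (fun k => Rabs (a k)).
Proof.
  induction N as [|N IH]; cbn [SZ].
  - rewrite Rabs_R0; lra.
  - eapply Rle_trans; [apply Rabs_triang|].
    apply Rplus_le_compat; auto. apply Rabs_triang.
Qed.

Lemma SZ_incr N M a : (forall k, 0 <= a k) -> (N <= M)%nat -> SZ N a <= SZ M a.
Proof.
  intros H HNM; induction HNM as [|M _ IH]; cbn [SZ]; try lra.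
  generalize (H (Z.of_nat M)) (H (- Z.of_nat (S M))%Z); lra.
Qed.

Lemma SZ_swap N M (t : Z -> Z -> R) :
  SZ N (fun k => SZ M (t k)) = SZ M (fun l => SZ N (fun k => t k l)).
Proof.
  induction N as [|N IH]; cbn [SZ].
  - symmetry; apply SZ_zero.
  - rewrite IH, !SZ_plus; lra.
Qed.

Lemma SZ_single N a k :
  (forall j, 0 <= a j) -> (- Z.of_nat N <= k < Z.of_nat N)%Z -> a k <= SZ N a.
Proof.
  intros H; induction N as [|N IH]; intros Hk; [lia|]; cbn [SZ].
  pose proof (SZ_nonneg N a H) as H0.
  pose proof (H (Z.of_nat N)) as H1.
  pose proof (H (- Z.of_nat (S N))%Z) as H2.
  destruct (Z.eq_dec k (Z.of_nat N)) as [->|]; [lra|].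
  destruct (Z.eq_dec k (- Z.of_nat (S N))) as [->|]; [lra|].
  assert (a k <= SZ N a) by (apply IH; lia). lra.
Qed.

Lemma SZ_diag N a :
  SZ N (fun k => SZ N (fun l => if Z.eq_dec k l then a k else 0)) = SZ N a.
Proof.
  assert (H : forall M k, SZ M (fun l => if Z.eq_dec k l then a k else 0) =
      if Z_le_dec (- Z.of_nat M) k then if Z_lt_dec k (Z.of_nat M) then a k else 0
      else 0).
  { intros M k; induction M as [|M IH]; cbn [SZ].
    - destruct (Z_le_dec (- Z.of_nat 0) k); auto.
      destruct (Z_lt_dec k (Z.of_nat 0)); auto. lia.
    - rewrite IH. repeat destruct (Z_le_dec _ _); repeat destruct (Z_lt_dec _ _);
        repeat destruct (Z.eq_dec _ _); subst; try lia; lra. }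
  rewrite (SZ_ext N _ _ (H N)).
  assert (H' : forall P, (P <= N)%nat -> SZ P (fun k =>
      if Z_le_dec (- Z.of_nat N) k then if Z_lt_dec k (Z.of_nat N) then a k else 0
      else 0) = SZ P a).
  { induction P as [|P IH]; intros HP; cbn [SZ]; auto.
    rewrite IH by lia.
    repeat destruct (Z_le_dec _ _); repeat destruct (Z_lt_dec _ _); try lia; auto. }
  apply H'; auto.
Qed.

Lemma SZ_sq N a : SZ N (fun k => SZ N (fun l => a k * a l)) = SZ N a * SZ N a.
Proof.
  rewrite (SZ_ext N _ (fun k => SZ N a * a k)).
  - apply SZ_scal.
  - intros k; rewrite SZ_scal; ring.
Qed.

Lemma SZ_lim N (u : nat -> Z -> R) (v : Z -> R) :
  (forall k, is_lim_seq (fun n => u n k) (v k)) ->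
  is_lim_seq (fun n => SZ N (u n)) (SZ N v).
Proof.
  intros H; induction N as [|N IH]; cbn [SZ].
  - apply is_lim_seq_const.
  - apply (is_lim_seq_plus' _ _ _ _ IH). apply is_lim_seq_plus'; apply H.
Qed.

(** * Series over the integers *)

Lemma SZ_sum_n N a :
  SZ (S N) a = sum_n (fun n : nat => a (Z.of_nat n)) N +
               sum_n (fun n : nat => a (- Z.of_nat (S n))%Z) N.
Proof.
  induction N as [|N IH].
  - rewrite !sum_O; cbn [SZ]; ring.
  - rewrite !sum_Sn. change (SZ (S (S N)) a) with
      (SZ (S N) a + (a (Z.of_nat (S N)) + a (- Z.of_nat (S (S N)))%Z)).
    rewrite IH; unfold plus; simpl plus; unfold plus; simpl. ring.
Qed.

Lemma sumZ_lim a : ex_sumZ a -> is_lim_seq (fun N => SZ N a) (sumZ a).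
Proof.
  intros [H1 H2]. apply is_lim_seq_incr_1.
  eapply is_lim_seq_ext; [intros n; symmetry; apply SZ_sum_n|].
  apply is_lim_seq_plus'.
  - apply Series_correct in H1; exact H1.
  - apply Series_correct in H2; exact H2.
Qed.

Lemma ex_series_bounded (u : nat -> R) M :
  (forall n, sum_n (fun i => Rabs (u i)) n <= M) -> ex_series u.
Proof.
  intros H. apply (ex_series_Rabs u).
  destruct (ex_finite_lim_seq_incr (sum_n (fun i => Rabs (u i))) M) as [l Hl]; auto.
  - intros n; rewrite sum_Sn; unfold plus; simpl.
    generalize (Rabs_pos (u (S n))); lra.
  - exists l; exact Hl.
Qed.

Lemma ex_sumZ_bounded a M :
  (forall N, SZ N (fun k => Rabs (a k)) <= M) -> ex_sumZ a.
Proof.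
  intros H.
  assert (Hp : forall (v : nat -> R) n, 0 <= sum_n (fun i => Rabs (v i)) n).
  { intros v n; induction n as [|n IH].
    - rewrite sum_O; apply Rabs_pos.
    - rewrite sum_Sn; unfold plus; simpl. generalize (Rabs_pos (v (S n))); lra. }
  split; apply (ex_series_bounded _ M); intros n;
    generalize (H (S n)); rewrite SZ_sum_n.
  - generalize (Hp (fun n : nat => a (- Z.of_nat (S n))%Z) n); lra.
  - generalize (Hp (fun n : nat => a (Z.of_nat n)) n); lra.
Qed.

Lemma ex_sumZ_ext a b : (forall k, a k = b k) -> ex_sumZ a -> ex_sumZ b.
Proof.
  intros H [H1 H2]; split; [eapply ex_series_ext, H1|eapply ex_series_ext, H2];
    intros n; apply H.
Qed.

Lemma SZ_le_sumZ a N : (forall k, 0 <= a k) -> ex_sumZ a -> SZ N a <= sumZ a.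
Proof.
  intros H He. apply (is_lim_seq_incr_compare (fun N => SZ N a)).
  - apply sumZ_lim; auto.
  - intros n; apply SZ_incr; auto.
Qed.

Lemma sumZ_nonneg a : (forall k, 0 <= a k) -> ex_sumZ a -> 0 <= sumZ a.
Proof. intros H He. apply (SZ_le_sumZ a 0 H He). Qed.

Lemma sumZ_ext a b : (forall k, a k = b k) -> sumZ a = sumZ b.
Proof. intros H; unfold sumZ; f_equal; apply Series_ext; auto. Qed.

Lemma sumZ_comb a b p q : ex_sumZ a -> ex_sumZ b ->
  sumZ (fun k => a k * p + b k * q) = sumZ a * p + sumZ b * q.
Proof.
  intros [Ha1 Ha2] [Hb1 Hb2]; unfold sumZ.
  rewrite !Series_plus by (apply ex_series_scal_r; assumption).
  rewrite !Series_scal_r. ring.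
Qed.

(** Fubini for an absolutely summable family.  Beyond the [N]-th square
    the family has total mass at most [U - D N], where [D N] is the mass of
    that square and [U] the limit of these masses. *)
Lemma sumZ_sumZ_lim (t : Z -> Z -> R) M :
  (forall N, SZ N (fun k => SZ N (fun l => Rabs (t k l))) <= M) ->
  is_lim_seq (fun N => SZ N (fun k => SZ N (t k))) (sumZ (fun k => sumZ (t k))).
Proof.
  intros HM.
  set (D := fun N => SZ N (fun k => SZ N (fun l => Rabs (t k l)))).
  assert (Hrect : forall K L, (K <= L)%nat ->
      SZ K (fun k => SZ L (fun l => Rabs (t k l))) <= D L).
  { intros K L HKL. apply (SZ_incr K L); auto.
    intros k; apply SZ_nonneg; intros l; apply Rabs_pos. }
  assert (Hincr : forall n, D n <= D (S n)).
  { intros n; eapply Rle_trans; [|apply (Hrect n (S n)); lia].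
    apply SZ_le; intros k; apply SZ_incr; [intros; apply Rabs_pos|lia]. }
  destruct (ex_finite_lim_seq_incr D M Hincr HM) as [U HU].
  assert (HDU : forall n, D n <= U).
  { intros n; apply (is_lim_seq_incr_compare D U HU Hincr). }
  assert (Hrow : forall k, ex_sumZ (t k)).
  { intros k. apply (ex_sumZ_bounded _ M); intros N.
    set (P := Nat.max N (S (Z.abs_nat k))).
    eapply Rle_trans; [|apply (HM P)].
    eapply Rle_trans; [apply (SZ_incr N P); [intros; apply Rabs_pos|lia]|].
    apply (SZ_single P (fun k => SZ P (fun l => Rabs (t k l)))); [|lia].
    intros j; apply SZ_nonneg; intros l; apply Rabs_pos. }
  assert (Hrl : forall k, is_lim_seq (fun L => SZ L (t k)) (sumZ (t k))).
  { intros k; apply sumZ_lim; auto. }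
  assert (Hrows : ex_sumZ (fun k => sumZ (t k))).
  { apply (ex_sumZ_bounded _ M); intros K.
    assert (Hl : is_lim_seq (fun L => SZ K (fun k => Rabs (SZ (L + K) (t k))))
                   (SZ K (fun k => Rabs (sumZ (t k))))).
    { apply (SZ_lim K (fun L k => Rabs (SZ (L + K) (t k)))); intros k.
      apply (is_lim_seq_abs _ (sumZ (t k))).
      apply (is_lim_seq_incr_n (fun L => SZ L (t k)) K); apply Hrl. }
    apply (fun H => is_lim_seq_le _ (fun _ => M) _ M H Hl (is_lim_seq_const M)).
    intros L. eapply Rle_trans; [apply SZ_le; intros k; apply SZ_abs|].
    eapply Rle_trans; [apply Hrect; lia|apply HM]. }
  assert (Hclose : forall K,
      Rabs (SZ K (fun k => sumZ (t k)) - SZ K (fun k => SZ K (t k))) <= U - D K).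
  { intros K.
    assert (Hl : is_lim_seq (fun L => Rabs (SZ K (fun k => SZ (L + K) (t k)) -
        SZ K (fun k => SZ K (t k))))
        (Rabs (SZ K (fun k => sumZ (t k)) - SZ K (fun k => SZ K (t k))))).
    { apply (is_lim_seq_abs _ (SZ K (fun k => sumZ (t k)) - SZ K (fun k => SZ K (t k)))).
      apply is_lim_seq_minus'; [|apply is_lim_seq_const].
      apply (SZ_lim K (fun L k => SZ (L + K) (t k))); intros k.
      apply (is_lim_seq_incr_n (fun L => SZ L (t k)) K); apply Hrl. }
    apply (fun H => is_lim_seq_le _ (fun _ => U - D K) _ (U - D K) H Hl
             (is_lim_seq_const _)).
    intros L. rewrite <- SZ_minus.
    eapply Rle_trans; [apply SZ_abs|].
    eapply Rle_trans with (SZ K (fun k => SZ (L + K) (fun l => Rabs (t k l)) -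
                                           SZ K (fun l => Rabs (t k l)))).
    - apply SZ_le; intros k. induction L as [|L IH].
      + simpl. rewrite !Rminus_diag, Rabs_R0; lra.
      + cbn [SZ Nat.add]. revert IH.
        set (p := SZ (L + K) (t k)); set (q := SZ K (t k)).
        set (u := t k (Z.of_nat (L + K))).
        set (v := t k (- Z.of_nat (S (L + K)))%Z). intros IH.
        replace (p + (u + v) - q) with ((p - q) + (u + v)) by ring.
        generalize (Rabs_triang (p - q) (u + v)) (Rabs_triang u v); lra.
    - rewrite SZ_minus. generalize (Hrect K (L + K)%nat ltac:(lia)) (HDU (L + K)%nat).
      unfold D at 3; lra. }
  pose proof (sumZ_lim _ Hrows) as Hs.
  assert (Hz : is_lim_seq (fun K => SZ K (fun k => SZ K (t k)) -
                 SZ K (fun k => sumZ (t k))) 0).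
  { apply is_lim_seq_abs_0.
    apply (is_lim_seq_le_le (fun _ => 0) _ (fun K => U - D K)).
    - intros K; split; [apply Rabs_pos|]. rewrite Rabs_minus_sym; apply Hclose.
    - apply is_lim_seq_const.
    - replace 0 with (U - U) by ring.
      apply is_lim_seq_minus'; [apply is_lim_seq_const|exact HU]. }
  pose proof (is_lim_seq_plus' _ _ _ _ Hs Hz) as Hp.
  rewrite Rplus_0_r in Hp.
  eapply is_lim_seq_ext; [|exact Hp]. intros n; simpl; ring.
Qed.

(** * A summable convolution kernel *)

(** A form of the Japanese bracket. *)
Definition jap (n : Z) : R := 1 + Rabs (IZR n).

Lemma jap_ge_1 n : 1 <= jap n.
Proof. unfold jap; generalize (Rabs_pos (IZR n)); lra. Qed.

Lemma jap_pos n : 0 < jap n.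
Proof. generalize (jap_ge_1 n); lra. Qed.

Lemma jap_opp n : jap (- n) = jap n.
Proof. unfold jap; now rewrite opp_IZR, Rabs_Ropp. Qed.

Lemma jap_sym k l : jap (k - l) = jap (l - k).
Proof. rewrite <- jap_opp; f_equal; ring. Qed.

(** The bounded increasing function [2 j / (1 + |j|)] has increments that dominate
    the kernel; this bounds the sums of the kernel uniformly in its shift. *)
Lemma jap_telescope j :
  / jap j ^ 2 <= 2 * IZR (j + 1) / jap (j + 1) - 2 * IZR j / jap j.
Proof.
  unfold jap. rewrite plus_IZR. destruct (Z_le_dec 0 j) as [H|H].
  - apply IZR_le in H. set (x := IZR j) in *. rewrite !Rabs_pos_eq by lra.
    replace (2 * (x + 1) / (1 + (x + 1)) - 2 * x / (1 + x))
      with (/ (1 + x) ^ 2 + x / ((1 + x) ^ 2 * (2 + x))) by (field; lra).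
    assert (0 <= x / ((1 + x) ^ 2 * (2 + x))); [|lra].
    apply Rle_mult_inv_pos; [lra|]. apply Rmult_lt_0_compat; [apply pow_lt|]; lra.
  - assert (H' : (j + 1 <= 0)%Z) by lia. apply IZR_le in H'. rewrite plus_IZR in H'.
    set (x := IZR j) in *. rewrite !Rabs_left1 by lra.
    replace (2 * (x + 1) / (1 + - (x + 1)) - 2 * x / (1 + - x))
      with (/ (1 + - x) ^ 2 + (2 - x) / (- x * (1 - x) ^ 2)) by (field; lra).
    assert (0 <= (2 - x) / (- x * (1 - x) ^ 2)); [|lra].
    apply Rle_mult_inv_pos; [lra|]. apply Rmult_lt_0_compat; [|apply pow_lt]; lra.
Qed.

Lemma SZ_jap N k : SZ N (fun l => / jap (l - k) ^ 2) <= 4.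
Proof.
  set (phi := fun j : Z => 2 * IZR j / jap j).
  assert (Hphi : forall j, -2 <= phi j <= 2).
  { intros j; unfold phi. pose proof (jap_pos j) as Hj.
    assert (Hab : - jap j <= IZR j <= jap j)
      by (unfold jap; unfold Rabs; destruct (Rcase_abs _); lra).
    split.
    - apply Rmult_le_reg_r with (jap j); auto. field_simplify; lra.
    - apply Rmult_le_reg_r with (jap j); auto. field_simplify; lra. }
  assert (H : SZ N (fun l => / jap (l - k) ^ 2) <=
      phi (Z.of_nat N - k)%Z - phi (- Z.of_nat N - k)%Z).
  { induction N as [|N IH]; cbn [SZ].
    - simpl; lra.
    - pose proof (jap_telescope (Z.of_nat N - k)) as H1.
      pose proof (jap_telescope (- Z.of_nat (S N) - k)) as H2.
      fold (phi (Z.of_nat N - k)%Z) (phi (Z.of_nat N - k + 1)%Z) in H1.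
      fold (phi (- Z.of_nat (S N) - k)%Z) (phi (- Z.of_nat (S N) - k + 1)%Z) in H2.
      replace (Z.of_nat N - k + 1)%Z with (Z.of_nat (S N) - k)%Z in H1 by lia.
      replace (- Z.of_nat (S N) - k + 1)%Z with (- Z.of_nat N - k)%Z in H2 by lia.
      lra. }
  generalize (Hphi (Z.of_nat N - k)%Z) (Hphi (- Z.of_nat N - k)%Z); lra.
Qed.

(** Schur's test: [v k * v l] is at most the mean of [v k ^ 2] and [v l ^ 2], and
    the rows and columns of the kernel have sums at most 4. *)
Lemma SZ_schur N (v : Z -> R) :
  SZ N (fun k => SZ N (fun l => / jap (k - l) ^ 2 * (v k * v l)))
  <= 4 * SZ N (fun k => v k ^ 2).
Proof.
  assert (Hi : forall n, 0 < / jap n ^ 2)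
    by (intros n; apply Rinv_0_lt_compat, pow_lt, jap_pos).
  assert (H : SZ N (fun k => SZ N (fun l => / jap (l - k) ^ 2 * v k ^ 2))
              <= 4 * SZ N (fun k => v k ^ 2)).
  { rewrite <- SZ_scal. apply SZ_le; intros k.
    rewrite (SZ_ext N _ (fun l => v k ^ 2 * / jap (l - k) ^ 2)) by (intros; ring).
    rewrite SZ_scal. generalize (SZ_jap N k) (pow2_ge_0 (v k)); nra. }
  eapply Rle_trans with (SZ N (fun k => SZ N (fun l =>
    / 2 * (/ jap (l - k) ^ 2 * v k ^ 2) + / 2 * (/ jap (l - k) ^ 2 * v l ^ 2)))).
  - apply SZ_le; intros k; apply SZ_le; intros l. rewrite (jap_sym k l).
    generalize (Hi (l - k)%Z) (pow2_ge_0 (v k - v l)). intros; nra.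
  - rewrite (SZ_ext N _ (fun k => / 2 * SZ N (fun l => / jap (l - k) ^ 2 * v k ^ 2)
        + / 2 * SZ N (fun l => / jap (l - k) ^ 2 * v l ^ 2)))
      by (intros k; rewrite SZ_plus, !SZ_scal; reflexivity).
    rewrite SZ_plus, !SZ_scal.
    rewrite (SZ_swap N N (fun k l => / jap (l - k) ^ 2 * v l ^ 2)).
    rewrite (SZ_ext N (fun l => SZ N (fun k => / jap (l - k) ^ 2 * v l ^ 2))
       (fun k => SZ N (fun l => / jap (l - k) ^ 2 * v k ^ 2)))
      by (intros k; apply SZ_ext; intros l; now rewrite jap_sym).
    lra.
Qed.

(** * Functions with bounded derivatives *)

(** Passing from [g] to [Derive g], instead of quantifying over the iterated
    derivatives of [g], lets products, inverses and square roots be estimated by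
    induction on [n], without a formula for their higher derivatives.  A single
    bound [B] for all orders keeps these estimates multiplicative in [B]. *)
Fixpoint CB (n : nat) (g : R -> R) (B : R) : Prop :=
  (forall x, Rabs (g x) <= B) /\
  match n with
  | O => True
  | S p => (forall x, ex_derive g x) /\ CB p (Derive g) B
  end.

Lemma CB_bound n g B x : CB n g B -> Rabs (g x) <= B.
Proof. destruct n; intros [H _]; apply H. Qed.

Lemma CB_ex_derive n g B x : CB (S n) g B -> ex_derive g x.
Proof. intros [_ [H _]]; apply H. Qed.

Lemma CB_continuous n g B x : CB (S n) g B -> continuous g x.
Proof. intros H; apply (ex_derive_continuous (V := R_NormedModule)), (CB_ex_derive n g B x H). Qed.

Lemma CB_nonneg n g B : CB n g B -> 0 <= B.
Proof.
  intros H; eapply Rle_trans; [apply Rabs_pos|apply (CB_bound n g B 0 H)].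
Qed.

Lemma CB_ext n f g B : (forall x, f x = g x) -> CB n f B -> CB n g B.
Proof.
  revert f g; induction n as [|n IH]; intros f g E [H1 H2]; split;
    try (intros x; rewrite <- E; apply H1); auto.
  destruct H2 as [H2 H3]; split.
  - intros x; apply (ex_derive_ext f); auto.
  - apply (IH (Derive f)); auto. intros x; apply Derive_ext; auto.
Qed.

Lemma CB_le n g B B' : B <= B' -> CB n g B -> CB n g B'.
Proof.
  intros HB; revert g; induction n as [|n IH]; intros g [H1 H2]; split;
    try (intros x; eapply Rle_trans; [apply H1|exact HB]); auto.
  destruct H2 as [H2 H3]; split; auto.
Qed.

Lemma CB_pred n g B : CB (S n) g B -> CB n g B.
Proof.
  revert g; induction n as [|n IH]; intros g [H1 [H2 H3]]; split; auto.
Qed.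

Lemma CB_const n c : CB n (fun _ => c) (Rabs c).
Proof.
  assert (H0 : forall p B, 0 <= B -> CB p (fun _ => 0) B).
  { induction p as [|p IH]; intros B HB; split; auto;
      try (intros _; rewrite Rabs_R0; auto).
    split; [intros x; apply ex_derive_const|].
    apply (CB_ext p (fun _ => 0)); auto. intros x; now rewrite Derive_const. }
  destruct n as [|n]; split; auto; try (intros _; apply Rle_refl).
  split; [intros x; apply ex_derive_const|].
  apply (CB_ext n (fun _ => 0)); [|apply H0, Rabs_pos].
  intros x; now rewrite Derive_const.
Qed.

Lemma CB_plus n f g A B : CB n f A -> CB n g B -> CB n (fun x => f x + g x) (A + B).
Proof.
  revert f g; induction n as [|n IH]; intros f g [F1 F2] [G1 G2]; split; auto;
    try (intros x; eapply Rle_trans; [apply Rabs_triang|]; apply Rplus_le_compat; auto).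
  destruct F2 as [F2 F3], G2 as [G2 G3]; split.
  - intros x; apply (ex_derive_plus (V := R_NormedModule) f g); auto.
  - apply (CB_ext n (fun x => Derive f x + Derive g x)); auto.
    intros x; rewrite Derive_plus; auto.
Qed.

Lemma CB_mult n f g A B :
  CB n f A -> CB n g B -> CB n (fun x => f x * g x) (2 ^ n * (A * B)).
Proof.
  revert f g; induction n as [|n IH]; intros f g F G.
  - destruct F as [F _], G as [G _]; split; auto.
    intros x; rewrite Rabs_mult; simpl; rewrite Rmult_1_l.
    apply Rmult_le_compat; auto using Rabs_pos.
  - pose proof (CB_nonneg _ _ _ F) as HA; pose proof (CB_nonneg _ _ _ G) as HB.
    pose proof (CB_pred _ _ _ F) as F0; pose proof (CB_pred _ _ _ G) as G0.
    pose proof (Rmult_le_pos _ _ HA HB) as HAB.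
    pose proof F as [F1 [F2 F3]]; pose proof G as [G1 [G2 G3]].
    assert (Hp : 1 <= 2 ^ S n) by (apply pow_R1_Rle; lra).
    split; [|split].
    + intros x; rewrite Rabs_mult.
      apply Rle_trans with (A * B); [|nra].
      apply Rmult_le_compat; auto using Rabs_pos.
    + intros x; apply (ex_derive_mult f g); auto.
    + apply (CB_ext n (fun x => Derive f x * g x + f x * Derive g x)).
      * intros x; rewrite Derive_mult; auto.
      * replace (2 ^ S n * (A * B)) with (2 ^ n * (A * B) + 2 ^ n * (A * B))
          by (simpl; ring).
        apply CB_plus; apply IH; auto.
Qed.

Lemma CB_scal n c f A : CB n f A -> CB n (fun x => c * f x) (2 ^ n * (Rabs c * A)).
Proof. intros H; apply (CB_mult n (fun _ => c)); auto using CB_const. Qed.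

Lemma CB_opp n f A : CB n f A -> CB n (fun x => - f x) A.
Proof.
  revert f; induction n as [|n IH]; intros f [H1 H2]; split; auto;
    try (intros x; rewrite Rabs_Ropp; auto).
  destruct H2 as [H2 H3]; split.
  - intros x; apply (ex_derive_opp (V := R_NormedModule) f); auto.
  - apply (CB_ext n (fun x => - Derive f x)); auto.
    intros x; rewrite Derive_opp; auto.
Qed.

Lemma CB_minus n f g A B : CB n f A -> CB n g B -> CB n (fun x => f x - g x) (A + B).
Proof. intros F G; apply CB_plus; auto using CB_opp. Qed.

(** The induction rests on [(1/s)' = - s' (1/s) (1/s)], whose right-hand side
    only involves the first [n] derivatives of [1/s] and of [s']. *)
Lemma CB_inv n : forall A, exists K, forall s beta,
  0 < beta -> (forall x, beta <= s x) -> CB n s (A * beta) ->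
  CB n (fun x => / s x) (K * / beta).
Proof.
  induction n as [|n IH]; intros A.
  - exists 1; intros s beta Hb Hs _; split; auto. intros x.
    rewrite Rabs_pos_eq by (left; apply Rinv_0_lt_compat; specialize (Hs x); lra).
    rewrite Rmult_1_l; apply Rinv_le_contravar; auto.
  - destruct (IH A) as [K HK].
    exists (Rmax 1 (2 ^ n * (2 ^ n * (A * K) * K))).
    intros s beta Hb Hs HCB.
    assert (Hi : 0 < / beta) by (apply Rinv_0_lt_compat; auto).
    pose proof (HK s beta Hb Hs (CB_pred _ _ _ HCB)) as Hinv.
    pose proof HCB as [S1 [S2 S3]].
    split; [|split].
    + intros x.
      rewrite Rabs_pos_eq by (left; apply Rinv_0_lt_compat; specialize (Hs x); lra).
      apply Rle_trans with (/ beta); [apply Rinv_le_contravar; auto|].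
      generalize (Rmax_l 1 (2 ^ n * (2 ^ n * (A * K) * K))); nra.
    + intros x. apply (ex_derive_inv s); auto. specialize (Hs x); lra.
    + apply (CB_ext n (fun x => - (Derive s x * / s x * / s x))).
      * intros x; rewrite Derive_inv; auto; [|specialize (Hs x); lra].
        field. specialize (Hs x); lra.
      * apply CB_opp.
        apply (CB_le n _ (2 ^ n * (2 ^ n * ((A * beta) * (K * / beta)) * (K * / beta)))).
        -- replace (2 ^ n * (2 ^ n * (A * beta * (K * / beta)) * (K * / beta)))
             with (2 ^ n * (2 ^ n * (A * K) * K) * / beta) by (field; lra).
           apply Rmult_le_compat_r; [lra|apply Rmax_r].
        -- apply CB_mult; auto. apply CB_mult; auto.
Qed.

(** Here the induction rests on [(sqrt a)' = a' / (2 sqrt a)] and on [CB_inv]. *)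
Lemma CB_sqrt n : forall A, exists K, forall (a : R -> R) beta,
  0 < beta -> (forall x, beta ^ 2 <= a x) -> CB n a (A * beta ^ 2) ->
  CB n (fun x => sqrt (a x)) (K * beta).
Proof.
  assert (Hbd : forall A (a : R -> R) beta, 0 < beta -> (forall x, beta ^ 2 <= a x) ->
      (forall x, Rabs (a x) <= A * beta ^ 2) ->
      forall x, Rabs (sqrt (a x)) <= Rmax 1 A * beta).
  { intros A a beta Hb Ha HA x.
    rewrite Rabs_pos_eq by apply sqrt_pos.
    assert (H1 : 1 <= Rmax 1 A) by apply Rmax_l.
    assert (H2 : A <= Rmax 1 A) by apply Rmax_r.
    rewrite <- (sqrt_pow2 (Rmax 1 A * beta)) by nra.
    apply sqrt_le_1_alt.
    eapply Rle_trans; [apply Rle_abs|]. eapply Rle_trans; [apply HA|].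
    rewrite Rpow_mult_distr. apply Rmult_le_compat_r; nra. }
  induction n as [|n IH]; intros A.
  - exists (Rmax 1 A); intros a beta Hb Ha [H _]; split; auto.
  - destruct (IH A) as [K HK]. destruct (CB_inv n K) as [L HL].
    exists (Rmax (Rmax 1 A) (2 ^ n * (Rabs (/ 2) * (2 ^ n * (A * L))))).
    intros a beta Hb Ha HCB.
    pose proof (HK a beta Hb Ha (CB_pred _ _ _ HCB)) as Hs.
    assert (Hge : forall x, beta <= sqrt (a x)).
    { intros x; rewrite <- (sqrt_pow2 beta) by lra. apply sqrt_le_1_alt; auto. }
    pose proof (HL _ beta Hb Hge Hs) as Hi.
    pose proof HCB as [A1 [A2 A3]].
    assert (Hpos : forall x, 0 < a x)
      by (intros x; specialize (Ha x); assert (0 < beta ^ 2) by (apply pow_lt; auto); lra).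
    split; [|split].
    + intros x; eapply Rle_trans; [apply (Hbd A a beta Hb Ha A1)|].
      apply Rmult_le_compat_r; [lra|apply Rmax_l].
    + intros x. eexists. apply (is_derive_sqrt a x (Derive a x)); auto.
      apply Derive_correct; auto.
    + apply (CB_ext n (fun x => / 2 * (Derive a x * / sqrt (a x)))).
      * intros x. symmetry; apply is_derive_unique.
        replace (/ 2 * (Derive a x * / sqrt (a x)))
          with (Derive a x / (2 * sqrt (a x)))
          by (field; apply Rgt_not_eq; specialize (Hge x); lra).
        apply (is_derive_sqrt a x (Derive a x)); auto.
        apply Derive_correct; auto.
      * apply (CB_le n _ (2 ^ n * (Rabs (/ 2) * (2 ^ n * ((A * beta ^ 2) * (L * / beta)))))).
        -- replace (2 ^ n * (Rabs (/ 2) * (2 ^ n * (A * beta ^ 2 * (L * / beta)))))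
             with (2 ^ n * (Rabs (/ 2) * (2 ^ n * (A * L))) * beta) by (field; lra).
           apply Rmult_le_compat_r; [lra|apply Rmax_r].
        -- apply CB_scal, CB_mult; auto.
Qed.

Lemma CB_Derive_n n g B :
  (forall i x, (i <= n)%nat -> ex_derive_n g i x) ->
  (forall i x, (i <= n)%nat -> Rabs (Derive_n g i x) <= B) -> CB n g B.
Proof.
  intros He Hb.
  assert (H : forall p i, (i + p = n)%nat -> CB p (Derive_n g i) B).
  { induction p as [|p IH]; intros i Hi; split; auto; try (intros x; apply Hb; lia).
    split.
    - intros x; apply (He (S i)); lia.
    - apply (IH (S i)); lia. }
  apply (H n 0%nat); auto.
Qed.

(** * Fourier coefficients *)

Definition mean (g : R -> R) : R := RInt g (- PI) PI / (2 * PI).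

Definition per (g : R -> R) : Prop := forall x, g (x + 2 * PI) = g x.

Definition trig (p q : R) (n : Z) (x : R) : R :=
  p * cos (IZR n * x) + q * sin (IZR n * x).

Lemma per_Derive g : per g -> per (Derive g).
Proof.
  intros H x; unfold Derive; f_equal; apply Lim_ext; intros h.
  replace (x + 2 * PI + h) with (x + h + 2 * PI) by ring. now rewrite !H.
Qed.

Lemma ex_RInt_cont (g : R -> R) : (forall x, continuous g x) -> ex_RInt g (- PI) PI.
Proof. intros H; apply (ex_RInt_continuous (V := R_CompleteNormedModule)); auto. Qed.

Lemma mean_ext f g : (forall x, f x = g x) -> mean f = mean g.
Proof. intros H; unfold mean; f_equal; apply RInt_ext; auto. Qed.

Lemma mean_plus (f g : R -> R) : (forall x, continuous f x) -> (forall x, continuous g x) ->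
  mean (fun x => f x + g x) = mean f + mean g.
Proof.
  intros F G; unfold mean.
  rewrite (RInt_plus (V := R_CompleteNormedModule) f g) by auto using ex_RInt_cont.
  unfold plus; simpl. field. apply PI_neq0.
Qed.

Lemma mean_scal c (f : R -> R) : (forall x, continuous f x) ->
  mean (fun x => c * f x) = c * mean f.
Proof.
  intros F; unfold mean.
  rewrite (RInt_scal (V := R_CompleteNormedModule) f) by auto using ex_RInt_cont.
  unfold scal; simpl; unfold mult; simpl. field. apply PI_neq0.
Qed.

Lemma mean_nonneg (f : R -> R) : (forall x, continuous f x) -> (forall x, 0 <= f x) -> 0 <= mean f.
Proof.
  intros F H; unfold mean. generalize PI_RGT_0; intros HP.
  apply Rle_mult_inv_pos; [|lra]. apply RInt_ge_0; auto using ex_RInt_cont; lra.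
Qed.

Lemma mean_bound (f : R -> R) B : (forall x, continuous f x) -> (forall x, Rabs (f x) <= B) ->
  Rabs (mean f) <= B.
Proof.
  intros F H; unfold mean. generalize PI_RGT_0; intros HP.
  unfold Rdiv. rewrite Rabs_mult, (Rabs_pos_eq (/ (2 * PI)))
    by (left; apply Rinv_0_lt_compat; lra).
  apply Rmult_le_reg_r with (2 * PI); [lra|].
  rewrite Rmult_assoc, Rinv_l, Rmult_1_r by lra.
  replace (B * (2 * PI)) with ((PI - - PI) * B) by ring.
  apply abs_RInt_le_const; auto using ex_RInt_cont; lra.
Qed.

Lemma continuous_trig p q n x : continuous (trig p q n) x.
Proof.
  apply (ex_derive_continuous (V := R_NormedModule)). unfold trig. auto_derive; auto.
Qed.

Lemma continuous_Rmult (f g : R -> R) (x : R) : continuous f x -> continuous g x ->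
  continuous (fun y => f y * g y) x.
Proof. intros F G; apply (continuous_mult (K := R_AbsRing) f g); auto. Qed.

Lemma continuous_Rplus (f g : R -> R) (x : R) : continuous f x -> continuous g x ->
  continuous (fun y => f y + g y) x.
Proof. intros F G; apply (continuous_plus (V := R_NormedModule) f g); auto. Qed.

Lemma trig_abs p q n x : Rabs (trig p q n x) <= Rabs p + Rabs q.
Proof.
  unfold trig. eapply Rle_trans; [apply Rabs_triang|]. rewrite !Rabs_mult.
  assert (Hc : Rabs (cos (IZR n * x)) <= 1) by (apply Rabs_le, COS_bound).
  assert (Hs : Rabs (sin (IZR n * x)) <= 1) by (apply Rabs_le, SIN_bound).
  generalize (Rabs_pos p) (Rabs_pos q); nra.
Qed.

Lemma trig_per p q n : per (trig p q n).
Proof.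
  intros x; unfold trig. rewrite Rmult_plus_distr_l.
  assert (H : forall y, cos (y + IZR n * (2 * PI)) = cos y /\
                        sin (y + IZR n * (2 * PI)) = sin y).
  { intros y. destruct (Z_le_dec 0 n) as [Hn|Hn].
    - rewrite <- (Z2Nat.id n Hn), <- INR_IZR_INZ.
      replace (INR (Z.to_nat n) * (2 * PI)) with (2 * INR (Z.to_nat n) * PI) by ring.
      split; [apply cos_period|apply sin_period].
    - set (m := Z.to_nat (- n)).
      assert (E : IZR n = - INR m).
      { unfold m; rewrite INR_IZR_INZ, Z2Nat.id, opp_IZR by lia; ring. }
      rewrite E. split.
      + rewrite <- (cos_period (y + - INR m * (2 * PI)) m); f_equal; ring.
      + rewrite <- (sin_period (y + - INR m * (2 * PI)) m); f_equal; ring. }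
  destruct (H (IZR n * x)) as [-> ->]; reflexivity.
Qed.

Lemma mean_trig_parts p q n g :
  (n <> 0)%Z -> per g -> (forall x, ex_derive g x) ->
  (forall x, continuous (Derive g) x) ->
  mean (fun x => trig p q n x * g x) =
  mean (fun x => trig (q / IZR n) (- (p / IZR n)) n x * Derive g x).
Proof.
  intros Hn Hper Hd Hc.
  assert (Hn' : IZR n <> 0) by (apply not_0_IZR; auto).
  set (G := trig (- (q / IZR n)) (p / IZR n) n).
  assert (HG : forall x, is_derive G x (trig p q n x)).
  { intros x; unfold G, trig. auto_derive; auto. field; auto. }
  assert (Hg : forall x, continuous g x)
    by (intros x; apply (ex_derive_continuous (V := R_NormedModule)); auto).
  assert (Ht : forall x, continuous (trig p q n) x) by (intros; apply continuous_trig).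
  assert (HGc : forall x, continuous G x) by (intros; apply continuous_trig).
  pose proof (is_RInt_scal_derive (V := R_CompleteNormedModule) G g (trig p q n)
     (Derive g) (- PI) PI (fun t _ => HG t) (fun t _ => Derive_correct g t (Hd t))
     (fun t _ => Ht t) (fun t _ => Hc t)) as HI.
  apply is_RInt_unique in HI.
  assert (E0 : minus (scal (G PI) (g PI)) (scal (G (- PI)) (g (- PI))) = 0).
  { assert (E : PI = - PI + 2 * PI) by ring.
    rewrite E at 1 2. rewrite (Hper (- PI)).
    unfold G at 1; rewrite (trig_per _ _ n (- PI)); fold G.
    apply (minus_eq_zero (G := R_AbelianGroup)). }
  assert (E1 : mean (fun t => trig p q n t * g t + G t * Derive g t) = 0).
  { unfold mean. transitivity (0 / (2 * PI)); [f_equal|unfold Rdiv; ring].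
    exact (eq_trans HI E0). }
  rewrite mean_plus in E1 by (intros x; apply continuous_Rmult; auto).
  rewrite (mean_ext (fun x => trig (q / IZR n) (- (p / IZR n)) n x * Derive g x)
            (fun x => -1 * (G x * Derive g x))).
  - rewrite mean_scal by (intros x; apply continuous_Rmult; auto). lra.
  - intros x; unfold G, trig; ring.
Qed.

(** Smoothness in [x] becomes decay in the frequency, one power for each
    integration by parts. *)
Lemma Fourier_decay M : forall p q n g B, per g -> CB (S M) g B ->
  Rabs (mean (fun x => trig p q n x * g x)) <=
  2 ^ M * (Rabs p + Rabs q) * B / jap n ^ M.
Proof.
  assert (H0 : forall M p q n g B, CB (S M) g B ->
    Rabs (mean (fun x => trig p q n x * g x)) <= (Rabs p + Rabs q) * B).
  { intros M' p q n g B HB. apply mean_bound.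
    - intros x; apply continuous_Rmult; [apply continuous_trig|].
      apply (CB_continuous M' g B); auto.
    - intros x; rewrite Rabs_mult. apply Rmult_le_compat; auto using Rabs_pos, trig_abs.
      apply (CB_bound (S M')); auto. }
  assert (HJ : forall n, (n <> 0)%Z -> jap n <= 2 * Rabs (IZR n)).
  { intros n Hn; unfold jap. assert (1 <= Rabs (IZR n)); [|lra].
    rewrite <- abs_IZR. apply IZR_le. lia. }
  induction M as [|M IH]; intros p q n g B Hper HB.
  - simpl. unfold Rdiv; rewrite Rinv_1, Rmult_1_r, Rmult_1_l. apply (H0 0%nat); auto.
  - destruct (Z.eq_dec n 0) as [->|Hn].
    + eapply Rle_trans; [apply (H0 (S M)); eauto|].
      unfold jap; rewrite Rabs_R0, Rplus_0_r, pow1.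
      pose proof (CB_nonneg _ _ _ HB) as HB0.
      assert (H1 : 0 <= (Rabs p + Rabs q) * B)
        by (apply Rmult_le_pos; auto; generalize (Rabs_pos p) (Rabs_pos q); lra).
      assert (1 <= 2 ^ S M) by (apply pow_R1_Rle; lra). unfold Rdiv. nra.
    + pose proof HB as [_ [HD HB']].
      rewrite mean_trig_parts; auto.
      2:{ intros x; apply (CB_continuous M _ B); auto. }
      eapply Rle_trans; [apply (IH _ _ _ _ B); auto using per_Derive|].
      rewrite Rabs_Ropp. unfold Rdiv. rewrite !Rabs_mult, Rabs_inv.
      assert (Hn' : 0 < Rabs (IZR n)) by (apply Rabs_pos_lt, not_0_IZR; auto).
      pose proof (jap_pos n) as HJ0. pose proof (HJ n Hn) as HJn.
      pose proof (CB_nonneg _ _ _ HB) as HB0.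
      assert (H1 : 0 <= 2 ^ M * (Rabs p + Rabs q) * B * / jap n ^ M).
      { apply Rmult_le_pos; [|left; apply Rinv_0_lt_compat, pow_lt; auto].
        apply Rmult_le_pos; auto. apply Rmult_le_pos; [apply pow_le; lra|].
        generalize (Rabs_pos p) (Rabs_pos q); lra. }
      replace (2 ^ M * (Rabs q * / Rabs (IZR n) + Rabs p * / Rabs (IZR n)) * B * / jap n ^ M)
        with (2 ^ M * (Rabs p + Rabs q) * B * / jap n ^ M * / Rabs (IZR n)) by ring.
      replace (2 ^ S M * (Rabs p + Rabs q) * B * / jap n ^ S M)
        with (2 ^ M * (Rabs p + Rabs q) * B * / jap n ^ M * (2 * / jap n))
        by (simpl; field; split; [apply pow_nonzero|]; lra).
      apply Rmult_le_compat_l; auto.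
      apply Rmult_le_reg_r with (jap n * Rabs (IZR n)); [nra|].
      field_simplify; lra.
Qed.

Lemma mean_trig_0 p q n : (n <> 0)%Z -> mean (trig p q n) = 0.
Proof.
  intros Hn.
  rewrite (mean_ext _ (fun x => trig p q n x * (fun _ => 1) x)) by (intros; ring).
  rewrite mean_trig_parts; auto.
  - rewrite (mean_ext _ (fun x => 0 * trig p q n x)).
    + rewrite mean_scal by (intros; apply continuous_trig). ring.
    + intros x; rewrite Derive_const; ring.
  - intros x; reflexivity.
  - intros x; apply ex_derive_const.
  - intros x. apply (continuous_ext (fun _ => 0)).
    + intros y; now rewrite Derive_const.
    + apply continuous_const.
Qed.

(** * The weight *)

Lemma Rpower_pos x y : 0 < Rpower x y.
Proof. apply exp_pos. Qed.

Lemma Rpower_double x s : Rpower x (2 * s) = Rpower x s ^ 2.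
Proof. replace (2 * s) with (s + s) by ring. rewrite Rpower_plus; ring. Qed.

Lemma Rpower_between c x X t : 0 < c -> c <= x -> x <= X ->
  Rpower x t <= Rpower c t + Rpower X t.
Proof.
  intros Hc H1 H2. generalize (Rpower_pos c t) (Rpower_pos X t); intros Pc PX.
  destruct (Rle_lt_dec 0 t) as [Ht|Ht].
  - apply Rle_trans with (Rpower X t); [apply Rle_Rpower_l; lra|lra].
  - apply Rle_trans with (Rpower c t); [|lra].
    replace t with (- - t) by ring. rewrite !(Rpower_Ropp _ (- t)).
    apply Rinv_le_contravar; [apply Rpower_pos|apply Rle_Rpower_l; lra].
Qed.

Lemma weight_pos Lambda mu : weight_function Lambda mu -> forall k, 0 < Lambda k.
Proof. now intros [H _]. Qed.

Lemma weight_mu_pos Lambda mu : weight_function Lambda mu -> 0 < mu.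
Proof. intros (_ & (mu0 & mu1 & c0 & c1 & H) & _); lra. Qed.

Lemma weight_lower Lambda mu : weight_function Lambda mu ->
  exists c, 0 < c /\ forall k, c <= Lambda k.
Proof.
  intros (_ & (mu0 & mu1 & c0 & c1 & H0 & H1 & H2 & H3 & H4 & H) & _).
  exists c0; split; auto. intros k. destruct (H k) as [Hk _].
  eapply Rle_trans; [|exact Hk].
  assert (1 <= Rpower (1 + Rabs (IZR k)) mu0); [|nra].
  apply Rle_trans with (Rpower (1 + Rabs (IZR k)) 0).
  - rewrite Rpower_O; [lra|apply (jap_pos k)].
  - apply Rle_Rpower; [|lra]. apply (jap_ge_1 k).
Qed.

(** The bound on [Delta Lambda] says that [Lambda ^ (1 / mu)] is Lipschitz: with
    [w = Lambda ^ (1 / mu)] it reads [|Delta Lambda| <= K Lambda / w], a relative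
    change of [Lambda], hence of [w], of size [1 / w]. *)
Lemma weight_Lipschitz Lambda mu : weight_function Lambda mu ->
  exists L, 0 < L /\ forall k,
    Rabs (Rpower (Lambda (k + 1)%Z) (/ mu) - Rpower (Lambda k) (/ mu)) <= L.
Proof.
  intros HW. pose proof (weight_pos _ _ HW) as Hpos.
  pose proof (weight_mu_pos _ _ HW) as Hmu.
  destruct (weight_lower _ _ HW) as (c & Hc & Hlow).
  destruct HW as (_ & _ & HD).
  destruct (HD 1%nat 0%nat (or_introl eq_refl)) as (K & HK & HKk).
  assert (Hi : 0 < / mu) by (apply Rinv_0_lt_compat; auto).
  set (w0 := Rpower c (/ mu)).
  assert (Hw0 : 0 < w0) by apply Rpower_pos.
  set (T := / mu * (K / w0)).
  assert (HT : 0 < T) by (apply Rmult_lt_0_compat; auto; apply Rdiv_lt_0_compat; auto).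
  exists (/ mu * K * exp T + 2 * K + / mu * (2 * K)). split.
  { assert (0 < / mu * K) by (apply Rmult_lt_0_compat; auto).
    generalize (exp_pos T); nra. }
  intros k.
  set (x := Lambda k). set (y := Lambda (k + 1)%Z).
  set (w := Rpower x (/ mu)). set (w' := Rpower y (/ mu)).
  assert (Hx : 0 < x) by apply Hpos. assert (Hy : 0 < y) by apply Hpos.
  assert (Hw : w0 <= w) by (apply Rle_Rpower_l; [lra|split; auto; apply Hlow]).
  assert (Hxy : Rabs (y - x) <= K * (x / w)).
  { specialize (HKk k).
    change (IZR k ^ 0 * Delta_n (1 + 0) Lambda k) with (1 * (y - x)) in HKk.
    rewrite Rmult_1_l in HKk.
    replace (x / w) with (Rpower (Lambda k) (1 - INR 1 / mu)); auto.
    fold x. replace (1 - INR 1 / mu) with (1 + - / mu) by (simpl; field; lra).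
    rewrite Rpower_plus, Rpower_1, Rpower_Ropp; auto. }
  assert (Hpow : forall t, Rpower (x * exp t) (/ mu) = w * exp (/ mu * t)).
  { intros t. rewrite <- Rpower_mult_distr; auto using exp_pos.
    unfold w, Rpower at 2. now rewrite ln_exp. }
  assert (HKw : K / w <= K / w0)
    by (apply Rmult_le_compat_l; [lra|apply Rinv_le_contravar; auto]).
  assert (HKw0 : 0 < K / w) by (apply Rdiv_lt_0_compat; lra).
  (* [1 + K / w <= exp (K / w)], and the exponent is bounded because [w >= w0]. *)
  assert (Hup : w' <= w + / mu * K * exp T).
  { apply Rle_trans with (w * exp (/ mu * (K / w))).
    - rewrite <- Hpow. apply Rle_Rpower_l; [lra|split; auto].
      apply Rle_trans with (x * (1 + K / w)).
      + apply Rabs_le_between in Hxy.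
        replace (x * (1 + K / w)) with (x + K * (x / w)) by (field; lra). lra.
      + apply Rmult_le_compat_l; [lra|].
        left; apply exp_ineq1; lra.
    - set (t := / mu * (K / w)).
      assert (Ht : 0 < t) by (apply Rmult_lt_0_compat; auto).
      assert (HtT : t <= T) by (apply Rmult_le_compat_l; lra).
      assert (He : exp t <= 1 + t * exp t).
      { assert (H1 : 1 + - t < exp (- t)) by (apply exp_ineq1; lra).
        rewrite exp_Ropp in H1. generalize (exp_pos t); intros Hp.
        assert (H2 : (1 + - t) * exp t < / exp t * exp t)
          by (apply Rmult_lt_compat_r; auto).
        rewrite Rinv_l in H2 by lra. lra. }
      assert (HeT : exp t <= exp T).
      { destruct HtT as [H|H]; [left; apply exp_increasing; auto|rewrite H; lra]. }
      assert (Hwt : w * t = / mu * K) by (unfold t; field; lra).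
      apply Rle_trans with (w * (1 + t * exp t)); [apply Rmult_le_compat_l; lra|].
      replace (w * (1 + t * exp t)) with (w + w * t * exp t) by ring.
      rewrite Hwt. apply Rplus_le_compat_l, Rmult_le_compat_l; auto.
      apply Rmult_le_pos; lra. }
  (* If [w > 2 K], then [t = K / w] satisfies [1 - t >= exp (- 2 t)]. *)
  assert (Hdown : w <= w' + 2 * K + / mu * (2 * K)).
  { destruct (Rle_lt_dec w (2 * K)) as [H|H].
    - assert (0 < w') by apply Rpower_pos.
      assert (0 < / mu * (2 * K)) by (apply Rmult_lt_0_compat; lra). lra.
    - assert (w - / mu * (2 * K) <= w'); [|lra].
      set (t := K / w) in *.
      assert (Ht : t <= / 2).
      { unfold t. apply Rmult_le_reg_r with w; [lra|].
        unfold Rdiv. rewrite Rmult_assoc, Rinv_l by lra. lra. }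
      assert (H1 : exp (- (2 * t)) <= 1 - t).
      { rewrite exp_Ropp. apply Rmult_le_reg_r with (exp (2 * t)); [apply exp_pos|].
        rewrite Rinv_l by apply Rgt_not_eq, exp_pos.
        assert (1 + 2 * t < exp (2 * t)) by (apply exp_ineq1; lra). nra. }
      apply Rle_trans with (w * exp (/ mu * - (2 * t))).
      + assert (H2 : 1 + / mu * - (2 * t) <= exp (/ mu * - (2 * t))).
        { left; apply exp_ineq1. apply Rlt_not_eq.
          assert (0 < / mu * (2 * t)) by (apply Rmult_lt_0_compat; lra). lra. }
        replace (w - / mu * (2 * K)) with (w * (1 + / mu * - (2 * t)))
          by (unfold t; field; lra).
        apply Rmult_le_compat_l; lra.
      + rewrite <- Hpow. apply Rle_Rpower_l; [lra|].
        split; [apply Rmult_lt_0_compat; auto using exp_pos|].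
        apply Rle_trans with (x * (1 - t)); [apply Rmult_le_compat_l; lra|].
        apply Rabs_le_between in Hxy.
        replace (x * (1 - t)) with (x - K * (x / w)) by (unfold t; field; lra). lra. }
  assert (H1 : 0 < / mu * K * exp T)
    by (apply Rmult_lt_0_compat; auto using exp_pos; apply Rmult_lt_0_compat; auto).
  assert (H2 : 0 < / mu * (2 * K)) by (apply Rmult_lt_0_compat; lra).
  apply Rabs_le; split; lra.
Qed.

(** Peetre's inequality.  For the power [1 / mu] it follows from the Lipschitz
    bound, because the weight is bounded below; other powers follow from this
    one, the negative ones by exchanging [k] and [l]. *)
Lemma weight_Peetre Lambda mu : weight_function Lambda mu ->
  forall s, exists K P, 0 < K /\ forall k l,
    Rpower (Lambda l) s <= K * Rpower (Lambda k) s * jap (k - l) ^ P.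
Proof.
  intros HW. pose proof (weight_pos _ _ HW) as Hpos.
  pose proof (weight_mu_pos _ _ HW) as Hmu.
  destruct (weight_lower _ _ HW) as (c & Hc & Hlow).
  destruct (weight_Lipschitz _ _ HW) as (L & HL & HLk).
  assert (Hi : 0 < / mu) by (apply Rinv_0_lt_compat; auto).
  set (w := fun k => Rpower (Lambda k) (/ mu)).
  set (w0 := Rpower c (/ mu)).
  assert (Hw0 : 0 < w0) by apply Rpower_pos.
  assert (Hw : forall k, w0 <= w k)
    by (intros k; apply Rle_Rpower_l; [lra|split; auto]).
  assert (Hstep : forall j k, Rabs (w (k + Z.of_nat j)%Z - w k) <= INR j * L).
  { induction j as [|j IH]; intros k.
    - simpl. rewrite Z.add_0_r, Rminus_diag, Rabs_R0; lra.
    - replace (k + Z.of_nat (S j))%Z with (k + Z.of_nat j + 1)%Z by lia.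
      specialize (IH k). specialize (HLk (k + Z.of_nat j)%Z).
      fold (w (k + Z.of_nat j)%Z) in HLk. fold (w (k + Z.of_nat j + 1)%Z) in HLk.
      rewrite S_INR.
      replace (w (k + Z.of_nat j + 1)%Z - w k) with
        ((w (k + Z.of_nat j + 1)%Z - w (k + Z.of_nat j)%Z) + (w (k + Z.of_nat j)%Z - w k))
        by ring.
      eapply Rle_trans; [apply Rabs_triang|]. lra. }
  assert (Hlip : forall k l, Rabs (w l - w k) <= Rabs (IZR (k - l)) * L).
  { intros k l. destruct (Z_le_dec k l) as [H|H].
    - specialize (Hstep (Z.to_nat (l - k)) k).
      rewrite INR_IZR_INZ, Z2Nat.id in Hstep by lia.
      replace (k + (l - k))%Z with l in Hstep by ring.
      rewrite <- abs_IZR. now replace (Z.abs (k - l)) with (l - k)%Z by lia.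
    - specialize (Hstep (Z.to_nat (k - l)) l).
      rewrite INR_IZR_INZ, Z2Nat.id in Hstep by lia.
      replace (l + (k - l))%Z with k in Hstep by ring.
      rewrite Rabs_minus_sym, <- abs_IZR.
      now replace (Z.abs (k - l)) with (k - l)%Z by lia. }
  set (D := 1 + L / w0).
  assert (HLw : 0 < L / w0) by (apply Rdiv_lt_0_compat; auto).
  assert (HD : 0 < D) by (unfold D; lra).
  assert (Hbase : forall k l, w l <= D * w k * jap (k - l)).
  { intros k l. specialize (Hlip k l). apply Rabs_le_between in Hlip.
    set (r := Rabs (IZR (k - l))) in *. unfold jap. fold r.
    assert (Hr : 0 <= r) by apply Rabs_pos. specialize (Hw k).
    assert (HLw' : L <= L / w0 * w k).
    { replace L with (L / w0 * w0) at 1 by (field; lra).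
      apply Rmult_le_compat_l; lra. }
    unfold D. assert (0 <= L / w0 * w k) by nra.
    assert (r * L <= r * (L / w0 * w k)) by (apply Rmult_le_compat_l; auto).
    assert (0 <= r * w k) by (apply Rmult_le_pos; lra).
    nra. }
  assert (Hnn : forall s, 0 <= s -> exists K P, 0 < K /\ forall k l,
     Rpower (Lambda l) s <= K * Rpower (Lambda k) s * jap (k - l) ^ P).
  { intros s Hs.
    assert (Hms : 0 <= mu * s) by (apply Rmult_le_pos; lra).
    destruct (INR_unbounded (mu * s)) as [P HP].
    exists (Rpower D (mu * s)), P. split; [apply Rpower_pos|]. intros k l.
    assert (HE : forall j, Rpower (Lambda j) s = Rpower (w j) (mu * s)).
    { intros j; unfold w. rewrite Rpower_mult. f_equal; field; lra. }
    rewrite !HE. pose proof (jap_ge_1 (k - l)) as HJ.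
    assert (Hwk : 0 < w k) by apply Rpower_pos.
    rewrite <- Rpower_pow by lra.
    apply Rle_trans with (Rpower (D * w k * jap (k - l)) (mu * s)).
    - apply Rle_Rpower_l; auto. split; [apply Rpower_pos|auto].
    - rewrite <- !Rpower_mult_distr; try lra; try (apply Rmult_lt_0_compat; lra).
      apply Rmult_le_compat_l.
      + left; apply Rmult_lt_0_compat; apply Rpower_pos.
      + apply Rle_Rpower; lra. }
  intros s. destruct (Rle_lt_dec 0 s) as [Hs|Hs]; auto.
  destruct (Hnn (- s)) as (K & P & HK & HKP); [lra|].
  exists K, P; split; auto. intros k l. specialize (HKP l k).
  rewrite !Rpower_Ropp in HKP. rewrite (jap_sym k l).
  generalize (Rpower_pos (Lambda k) s) (Rpower_pos (Lambda l) s).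
  set (a := Rpower (Lambda k) s) in *. set (b := Rpower (Lambda l) s) in *.
  set (J := jap (l - k) ^ P) in *. intros Ha Hb.
  apply Rmult_le_reg_r with (/ a * / b);
    [apply Rmult_lt_0_compat; apply Rinv_0_lt_compat; auto|].
  replace (b * (/ a * / b)) with (/ a) by (field; lra).
  replace (K * a * J * (/ a * / b)) with (K * / b * J) by (field; lra). auto.
Qed.

(** A lower power of the weight is negligible against a higher one where the
    weight is large, and bounded elsewhere. *)
Lemma weight_absorb Lambda mu s delta eps :
  weight_function Lambda mu -> 0 < delta -> 0 < eps ->
  exists K, 0 < K /\ forall k,
    Rpower (Lambda k) (s - delta) <= eps * Rpower (Lambda k) s + K.
Proof.
  intros HW Hd He. destruct (weight_lower _ _ HW) as (c & Hc & Hlow).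
  set (X := Rpower (/ eps) (/ delta)).
  exists (Rpower c (s - delta) + Rpower X (s - delta)). split.
  { generalize (Rpower_pos c (s - delta)) (Rpower_pos X (s - delta)); lra. }
  intros k. specialize (Hlow k). set (x := Lambda k) in *.
  generalize (Rpower_pos x s) (Rpower_pos c (s - delta)) (Rpower_pos X (s - delta)).
  intros P1 P2 P3.
  destruct (Rle_lt_dec X x) as [HX|HX].
  - assert (H1 : / eps <= Rpower x delta).
    { replace (/ eps) with (Rpower X delta).
      - apply Rle_Rpower_l; [lra|]. split; auto. apply Rpower_pos.
      - unfold X. rewrite Rpower_mult, Rinv_l, Rpower_1; auto; try lra.
        apply Rinv_0_lt_compat; auto. }
    assert (H2 : Rpower x (s - delta) <= eps * Rpower x s); [|lra].
    unfold Rminus. rewrite Rpower_plus, Rpower_Ropp, Rmult_comm.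
    apply Rmult_le_compat_r; [lra|].
    rewrite <- (Rinv_inv eps). apply Rinv_le_contravar; auto.
    apply Rinv_0_lt_compat; auto.
  - assert (H := Rpower_between c x X (s - delta) Hc Hlow (Rlt_le _ _ HX)).
    assert (0 < eps * Rpower x s) by (apply Rmult_lt_0_compat; auto). lra.
Qed.

(** * Symbols *)

Lemma finite_bound (Q : nat -> R -> Prop) :
  (forall i B B', B <= B' -> Q i B -> Q i B') ->
  (forall i, exists K, 0 < K /\ Q i K) ->
  forall n, exists K, 0 < K /\ forall i, (i <= n)%nat -> Q i K.
Proof.
  intros Hmon H; induction n as [|n (K & HK & HQ)].
  - destruct (H 0%nat) as (K & HK & HQ); exists K; split; auto.
    intros i Hi; now replace i with 0%nat by lia.
  - destruct (H (S n)) as (K' & HK' & HQ').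
    exists (K + K'); split; [lra|]. intros i Hi.
    destruct (Nat.eq_dec i (S n)) as [->|Hne].
    + apply (Hmon _ K'); auto; lra.
    + apply (Hmon _ K); [lra|]. apply HQ; lia.
Qed.

Lemma Cmod_Re_Im (z : C) : Rabs (Re z) <= Cmod z /\ Rabs (Im z) <= Cmod z.
Proof.
  pose proof (Rmax_Cmod z) as H.
  split; eapply Rle_trans; [|exact H| |exact H]; [apply Rmax_l|apply Rmax_r].
Qed.

Lemma symbol_bounds rho Lambda r sigma : symbol_class rho Lambda r sigma ->
  forall n, exists K, 0 < K /\ forall k,
    CB n (fun x => Re (sigma k x)) (K * Rpower (Lambda k) r) /\
    CB n (fun x => Im (sigma k x)) (K * Rpower (Lambda k) r).
Proof.
  intros (_ & Hsm & Hb) n.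
  destruct (finite_bound (fun i K => forall k x,
     Cmod (CDerive_n (sigma k) i x) <= K * Rpower (Lambda k) r)) with (n := n)
     as (K & HK & HQ).
  - intros i B B' HB H k x; eapply Rle_trans; [apply H|].
    apply Rmult_le_compat_r; auto. left; apply Rpower_pos.
  - intros i. destruct (Hb 0%nat i 0%nat (or_introl eq_refl)) as (K & HK & H).
    exists K; split; auto. intros k x. specialize (H k x).
    replace (r - rho * INR 0) with r in H by (simpl; ring).
    replace (CDerive_n (sigma k) i x) with (CDerive_n
      (fun y => (RtoC (IZR k ^ 0) * Delta_n 0 (fun j => sigma j y) k)%C) i x); auto.
    unfold CDerive_n; f_equal; apply Derive_n_ext; intros y; unfold Re, Im, Delta_n; simpl; ring.
  - exists K; split; auto. intros k; split; apply CB_Derive_n;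
      try (intros i x _; apply (Hsm k i x)); intros i x Hi;
      (eapply Rle_trans; [|apply (HQ i Hi k x)]);
      apply (Cmod_Re_Im (CDerive_n (sigma k) i x)).
Qed.

Lemma symbol_Delta_bounds rho Lambda r sigma : symbol_class rho Lambda r sigma ->
  forall n, exists K, 0 < K /\ forall k,
    CB n (fun x => Re (sigma (k + 1)%Z x) - Re (sigma k x))
         (K * Rpower (Lambda k) (r - rho)).
Proof.
  intros (_ & Hsm & Hb) n.
  assert (Hloc : forall k i x, locally x (fun y : R_UniformSpace => forall j : nat,
            (j <= i)%nat -> ex_derive_n (fun x => Re (sigma k x)) j y))
    by (intros k i x; apply filter_forall; intros y j _; apply (Hsm k j y)).
  destruct (finite_bound (fun i K => forall k x,
     Rabs (Derive_n (fun x => Re (sigma (k + 1)%Z x) - Re (sigma k x)) i x)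
     <= K * Rpower (Lambda k) (r - rho))) with (n := n) as (K & HK & HQ).
  - intros i B B' HB H k x; eapply Rle_trans; [apply H|].
    apply Rmult_le_compat_r; auto. left; apply Rpower_pos.
  - intros i. destruct (Hb 1%nat i 0%nat (or_introl eq_refl)) as (K & HK & H).
    exists K; split; auto. intros k x. specialize (H k x).
    replace (r - rho * INR 1) with (r - rho) in H by (simpl; ring).
    eapply Rle_trans; [|exact H].
    eapply Rle_trans; [|apply (proj1 (Cmod_Re_Im _))].
    rewrite Derive_n_minus by apply Hloc. right; f_equal.
    cbn -[Derive_n pow]. unfold Rminus.
    f_equal; [|f_equal]; apply Derive_n_ext; intros y; unfold Re, Im, Delta_n; simpl; ring.
  - exists K; split; auto. intros k; apply CB_Derive_n; auto.
    intros i x _; apply ex_derive_n_minus; apply Hloc.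
Qed.

(** Telescoping from [l] to [k]; Peetre's inequality moves all weights to [k],
    and the number of steps is absorbed by one more power of [jap (k - l)].  The
    exponent [P] does not depend on the number [n] of derivatives, so that [n]
    can be chosen after it. *)
Lemma symbol_difference rho Lambda mu r sigma :
  weight_function Lambda mu -> symbol_class rho Lambda r sigma ->
  exists P, forall n, exists K, 0 < K /\ forall k l,
    CB n (fun x => Re (sigma k x) - Re (sigma l x))
         (K * Rpower (Lambda k) (r - rho) * jap (k - l) ^ P).
Proof.
  intros HW HS.
  destruct (weight_Peetre _ _ HW (r - rho)) as (K1 & P & HK1 & HP).
  exists (P + S P)%nat. intros n.
  destruct (symbol_Delta_bounds _ _ _ _ HS n) as (K2 & HK2 & HD).
  assert (HJ1 : forall j p q, (p <= q)%nat -> jap j ^ p <= jap j ^ q)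
    by (intros; apply Rle_pow; auto; apply jap_ge_1).
  assert (Hup : forall j k, CB n
      (fun x => Re (sigma (k + Z.of_nat j)%Z x) - Re (sigma k x))
      (INR j * (K2 * K1 * Rpower (Lambda k) (r - rho) * jap (Z.of_nat j) ^ P))).
  { induction j as [|j IH]; intros k.
    - simpl INR. rewrite Rmult_0_l, <- Rabs_R0.
      apply (CB_ext n (fun _ => 0)); [|apply CB_const].
      intros x. rewrite Z.add_0_r; ring.
    - apply (CB_ext n (fun x =>
        (Re (sigma (k + Z.of_nat j)%Z x) - Re (sigma k x)) +
        (Re (sigma (k + Z.of_nat j + 1)%Z x) - Re (sigma (k + Z.of_nat j)%Z x)))).
      { intros x. replace (k + Z.of_nat (S j))%Z with (k + Z.of_nat j + 1)%Z by lia.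
        ring. }
      eapply CB_le; [|apply CB_plus; [apply IH|apply HD]].
      rewrite S_INR, Rmult_plus_distr_r, Rmult_1_l.
      generalize (Rpower_pos (Lambda k) (r - rho)); intros HR.
      assert (HJ : jap (Z.of_nat j) ^ P <= jap (Z.of_nat (S j)) ^ P).
      { apply pow_incr. split; [left; apply jap_pos|]. unfold jap.
        rewrite !Rabs_pos_eq by (apply IZR_le; lia).
        apply Rplus_le_compat_l, IZR_le; lia. }
      assert (HKK : 0 < K2 * K1 * Rpower (Lambda k) (r - rho))
        by (apply Rmult_lt_0_compat; auto; apply Rmult_lt_0_compat; auto).
      apply Rplus_le_compat.
      + apply Rmult_le_compat_l; [apply pos_INR|].
        apply Rmult_le_compat_l; lra.
      + eapply Rle_trans; [apply Rmult_le_compat_l; [lra|apply (HP k)]|].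
        replace (k - (k + Z.of_nat j))%Z with (- Z.of_nat j)%Z by ring.
        rewrite jap_opp.
        replace (K2 * (K1 * Rpower (Lambda k) (r - rho) * jap (Z.of_nat j) ^ P))
          with (K2 * K1 * Rpower (Lambda k) (r - rho) * jap (Z.of_nat j) ^ P) by ring.
        apply Rmult_le_compat_l; lra. }
  assert (Hle : forall k l, (k <= l)%Z -> CB n
      (fun x => Re (sigma l x) - Re (sigma k x))
      (K2 * K1 * Rpower (Lambda k) (r - rho) * jap (k - l) ^ S P)).
  { intros k l Hkl. specialize (Hup (Z.to_nat (l - k)) k).
    rewrite Z2Nat.id in Hup by lia. replace (k + (l - k))%Z with l in Hup by ring.
    eapply CB_le; [|exact Hup].
    rewrite INR_IZR_INZ, Z2Nat.id, (jap_sym k l) by lia.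
    assert (H1 : IZR (l - k) <= jap (l - k))
      by (unfold jap; generalize (Rle_abs (IZR (l - k))); lra).
    assert (0 <= K2 * K1 * Rpower (Lambda k) (r - rho) * jap (l - k) ^ P).
    { generalize (Rpower_pos (Lambda k) (r - rho)) (pow_lt _ P (jap_pos (l - k))).
      intros; repeat apply Rmult_le_pos; lra. }
    simpl. nra. }
  exists (K2 * K1 + K2 * K1 * K1). split.
  { assert (0 < K2 * K1) by (apply Rmult_lt_0_compat; auto).
    assert (0 < K2 * K1 * K1) by (apply Rmult_lt_0_compat; auto). lra. }
  intros k l.
  generalize (Rpower_pos (Lambda k) (r - rho)) (pow_lt _ (S P) (jap_pos (k - l)))
    (pow_lt _ (P + S P) (jap_pos (k - l))) (HJ1 (k - l)%Z (S P) (P + S P)%nat ltac:(lia)).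
  set (R0 := Rpower (Lambda k) (r - rho)).
  intros HR HJs HJb HJ.
  assert (H0 : 0 < K2 * K1 * R0) by (repeat apply Rmult_lt_0_compat; auto).
  assert (H0' : 0 < K2 * K1 * K1 * R0) by (repeat apply Rmult_lt_0_compat; auto).
  destruct (Z_le_dec k l) as [H|H].
  - apply (CB_ext n (fun x => - (Re (sigma l x) - Re (sigma k x)))); [intros; ring|].
    apply CB_opp. eapply CB_le; [|apply Hle; auto]. fold R0.
    apply Rle_trans with (K2 * K1 * R0 * jap (k - l) ^ (P + S P)); [nra|].
    apply Rmult_le_compat_r; lra.
  - eapply CB_le; [|apply Hle; lia]. rewrite (jap_sym l k).
    apply Rle_trans with (K2 * K1 * (K1 * R0 * jap (k - l) ^ P) * jap (k - l) ^ S P).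
    + apply Rmult_le_compat_r; [lra|]. apply Rmult_le_compat_l; [|apply HP].
      apply Rmult_le_pos; lra.
    + rewrite pow_add.
      replace (K2 * K1 * (K1 * R0 * jap (k - l) ^ P) * jap (k - l) ^ S P)
        with (K2 * K1 * K1 * R0 * (jap (k - l) ^ P * jap (k - l) ^ S P)) by ring.
      rewrite <- pow_add. apply Rmult_le_compat_r; lra.
Qed.

(** * The matrix of the operator *)

Definition kern (sigma : Z -> R -> C) (k l : Z) : C :=
  (RtoC (/ (2 * PI))
   * @RInt C_R_CompleteNormedModule
       (fun x : R => Cis (IZR (k - l) * x) * sigma k x) (- PI) PI)%C.

Definition cont_symbol (sigma : Z -> R -> C) : Prop :=
  forall k x, continuous (fun y => Re (sigma k y)) x /\
              continuous (fun y => Im (sigma k y)) x.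

Lemma symbol_cont rho Lambda r sigma :
  symbol_class rho Lambda r sigma -> cont_symbol sigma.
Proof.
  intros HS k x. destruct (symbol_bounds _ _ _ _ HS 1%nat) as (K & _ & H).
  destruct (H k) as [H1 H2].
  split; [apply (CB_continuous _ _ _ x H1)|apply (CB_continuous _ _ _ x H2)].
Qed.

Lemma mean_trig_lin p q n g : (forall x, continuous g x) ->
  mean (fun x => trig p q n x * g x) =
  p * mean (fun x => cos (IZR n * x) * g x) + q * mean (fun x => sin (IZR n * x) * g x).
Proof.
  intros Hg.
  assert (Hc : forall x, continuous (fun y => cos (IZR n * y)) x)
    by (intros x; apply (ex_derive_continuous (V := R_NormedModule)); auto_derive; auto).
  assert (Hs : forall x, continuous (fun y => sin (IZR n * y)) x)
    by (intros x; apply (ex_derive_continuous (V := R_NormedModule)); auto_derive; auto).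
  assert (Hcg : forall x, continuous (fun y => cos (IZR n * y) * g y) x)
    by (intros; apply continuous_Rmult; auto).
  assert (Hsg : forall x, continuous (fun y => sin (IZR n * y) * g y) x)
    by (intros; apply continuous_Rmult; auto).
  rewrite <- !mean_scal, <- mean_plus; auto.
  - apply mean_ext; intros x; unfold trig; ring.
  - intros x; apply continuous_Rmult; auto; apply continuous_const.
  - intros x; apply continuous_Rmult; auto; apply continuous_const.
Qed.

Lemma kern_Re sigma k l (z : C) : cont_symbol sigma ->
  Re (z * kern sigma k l)%C =
  mean (fun x => trig (Re z) (- Im z) (k - l) x * Re (sigma k x)) -
  mean (fun x => trig (Im z) (Re z) (k - l) x * Im (sigma k x)).
Proof.
  intros Hc. set (n := (k - l)%Z).
  assert (Hr : forall x, continuous (fun y => Re (sigma k y)) x) by apply Hc.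
  assert (Hi : forall x, continuous (fun y => Im (sigma k y)) x) by apply Hc.
  set (f := fun x => (Cis (IZR n * x) * sigma k x)%C).
  set (f1 := fun x => trig 1 0 n x * Re (sigma k x) + -1 * (trig 0 1 n x * Im (sigma k x))).
  set (f2 := fun x => trig 1 0 n x * Im (sigma k x) + trig 0 1 n x * Re (sigma k x)).
  assert (H1 : forall p q x, continuous (fun x => trig p q n x * Re (sigma k x)) x)
    by (intros; apply continuous_Rmult; auto using continuous_trig).
  assert (H2 : forall p q x, continuous (fun x => trig p q n x * Im (sigma k x)) x)
    by (intros; apply continuous_Rmult; auto using continuous_trig).
  assert (H2' : forall x, continuous (fun x => -1 * (trig 0 1 n x * Im (sigma k x))) x)
    by (intros; apply continuous_Rmult; auto; apply continuous_const).
  assert (HI : is_RInt (V := C_R_CompleteNormedModule) f (- PI) PI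
                 (RInt f1 (- PI) PI, RInt f2 (- PI) PI)).
  { apply (is_RInt_fct_extend_pair (U := R_NormedModule) (V := R_NormedModule) f).
    - apply (is_RInt_ext f1).
      + intros x _; unfold f, f1, trig, Cis; simpl; unfold Re, Im; ring.
      + apply (RInt_correct (V := R_CompleteNormedModule)), ex_RInt_cont.
        intros x; apply continuous_Rplus; auto.
    - apply (is_RInt_ext f2).
      + intros x _; unfold f, f2, trig, Cis; simpl; unfold Re, Im; ring.
      + apply (RInt_correct (V := R_CompleteNormedModule)), ex_RInt_cont.
        intros x; apply continuous_Rplus; auto. }
  assert (HK : kern sigma k l = (mean f1, mean f2)).
  { unfold kern. fold n.
    apply (is_RInt_unique (V := C_R_CompleteNormedModule)) in HI.
    unfold f in HI. rewrite HI. unfold mean, Rdiv, Cmult, RtoC; simpl.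
    f_equal; ring. }
  rewrite HK.
  assert (E1 : mean f1 = mean (fun x => trig 1 0 n x * Re (sigma k x)) -
                         mean (fun x => trig 0 1 n x * Im (sigma k x))).
  { unfold f1. rewrite mean_plus, mean_scal; auto. ring. }
  assert (E2 : mean f2 = mean (fun x => trig 1 0 n x * Im (sigma k x)) +
                         mean (fun x => trig 0 1 n x * Re (sigma k x))).
  { unfold f2. rewrite mean_plus; auto. }
  rewrite E1, E2. rewrite !mean_trig_lin by auto.
  unfold Re, Im; simpl. ring.
Qed.

Lemma kern_Im sigma k l (z : C) :
  Im (z * kern sigma k l)%C = Re ((Im z, (- Re z)%R) * kern sigma k l)%C.
Proof. unfold Re, Im; simpl; ring. Qed.

(** Row [k] consists of Fourier coefficients of [sigma k], whose derivatives the
    symbol class bounds by [Lambda k ^ r]; so [Fourier_decay] applies. *)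
Lemma kern_decay rho Lambda r sigma : symbol_class rho Lambda r sigma ->
  forall M, exists K, 0 < K /\ forall k l (z : C),
    Rabs (Re (z * kern sigma k l)%C) <=
    K * Cmod z * Rpower (Lambda k) r / jap (k - l) ^ M.
Proof.
  intros HS M. pose proof (symbol_cont _ _ _ _ HS) as Hc.
  destruct (symbol_bounds _ _ _ _ HS (S M)) as (K & HK & HB).
  pose proof HS as (Hper & _).
  assert (H2M : 0 < 2 ^ M) by (apply pow_lt; lra).
  exists (4 * 2 ^ M * K). split; [repeat apply Rmult_lt_0_compat; lra|].
  intros k l z. rewrite kern_Re by auto.
  destruct (HB k) as [HB1 HB2]. destruct (Cmod_Re_Im z) as [Hz1 Hz2].
  assert (HF1 := Fourier_decay M (Re z) (- Im z) (k - l) _ _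
     (fun x => f_equal Re (Hper k x)) HB1).
  assert (HF2 := Fourier_decay M (Im z) (Re z) (k - l) _ _
     (fun x => f_equal Im (Hper k x)) HB2).
  rewrite Rabs_Ropp in HF1.
  eapply Rle_trans; [apply Rabs_triang|]. rewrite Rabs_Ropp.
  eapply Rle_trans; [apply Rplus_le_compat; [exact HF1|exact HF2]|].
  generalize (Rinv_0_lt_compat _ (pow_lt _ M (jap_pos (k - l)))) (Rpower_pos (Lambda k) r).
  unfold Rdiv. set (J := / jap (k - l) ^ M). set (L := Rpower (Lambda k) r). intros HJ HL.
  assert (H0 : 0 < 2 ^ M * K * L * J) by (repeat apply Rmult_lt_0_compat; auto).
  replace (2 ^ M * (Rabs (Re z) + Rabs (Im z)) * (K * L) * J +
           2 ^ M * (Rabs (Im z) + Rabs (Re z)) * (K * L) * J)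
    with (2 ^ M * K * L * J * (2 * (Rabs (Re z) + Rabs (Im z)))) by ring.
  replace (4 * 2 ^ M * K * Cmod z * L * J) with (2 ^ M * K * L * J * (4 * Cmod z)) by ring.
  apply Rmult_le_compat_l; lra.
Qed.

(** * Square roots of an elliptic symbol *)

Lemma cofinite_tail (Q : Z -> Prop) : cofinitely_many Q ->
  exists N, forall k, N <= Rabs (IZR k) -> Q k.
Proof.
  intros [l Hl].
  assert (H : exists N, forall k, In k l -> Rabs (IZR k) < N).
  { clear Hl; induction l as [|j l (N & HN)].
    - exists 0; intros k [].
    - exists (Rmax N (Rabs (IZR j) + 1)). intros k [<-|Hk].
      + eapply Rlt_le_trans; [|apply Rmax_r]; lra.
      + eapply Rlt_le_trans; [apply HN, Hk|apply Rmax_l]. }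
  destruct H as (N & HN). exists N; intros k Hk. apply Hl; intros Hin.
  specialize (HN k Hin); lra.
Qed.

Lemma elliptic_tail Lambda r sigma :
  M_elliptic Lambda r sigma ->
  cofinitely_many (fun k => forall x, Cnonneg (sigma k x)) ->
  exists kappa N, 0 < kappa /\ forall k x, N <= Rabs (IZR k) ->
    Im (sigma k x) = 0 /\ kappa * Rpower (Lambda k) r <= Re (sigma k x).
Proof.
  intros (kappa & N1 & Hk & _ & H1) H2.
  destruct (cofinite_tail _ H2) as (N2 & HN2).
  exists kappa, (Rmax N1 N2). split; auto. intros k x HN.
  assert (N1 <= Rabs (IZR k)) as HN1 by (eapply Rle_trans; [apply Rmax_l|exact HN]).
  assert (N2 <= Rabs (IZR k)) as HN2' by (eapply Rle_trans; [apply Rmax_r|exact HN]).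
  destruct (HN2 k HN2' x) as [Hi Hr]. split; auto.
  replace (Re (sigma k x)) with (Cmod (sigma k x)); auto.
  replace (sigma k x) with (RtoC (Re (sigma k x))) at 1.
  - now rewrite Cmod_R, Rabs_pos_eq.
  - destruct (sigma k x) as [u v]; unfold Im, Re in *; simpl in *; subst; reflexivity.
Qed.

(** What is subtracted is a multiple of a value of the symbol, and not of
    [Lambda ^ r], in order that differences in [k] inherit the bounds of the
    symbol class. *)
Definition shifted (sigma : Z -> R -> C) (c : R) (k : Z) (x : R) : R :=
  Re (sigma k x) - c * Re (sigma k 0).

Definition root (sigma : Z -> R -> C) (c : R) (k : Z) (x : R) : R :=
  sqrt (shifted sigma c k x).

Lemma shifted_CB rho Lambda r sigma c : symbol_class rho Lambda r sigma ->
  forall n, exists K, 0 < K /\ forall k,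
    CB n (shifted sigma c k) (K * Rpower (Lambda k) r).
Proof.
  intros HS n. destruct (symbol_bounds _ _ _ _ HS n) as (K & HK & HB).
  pose proof (Rabs_pos c) as Hc.
  exists (K * (1 + Rabs c)). split; [apply Rmult_lt_0_compat; lra|].
  intros k. destruct (HB k) as [H _]. unfold shifted.
  eapply CB_le; [|apply CB_minus; [exact H|apply CB_const]].
  rewrite Rabs_mult.
  assert (Rabs (Re (sigma k 0)) <= K * Rpower (Lambda k) r)
    by apply (CB_bound _ _ _ 0 H). nra.
Qed.

(** The factorisation [b_k - b_l = (a_k - a_l) / (b_k + b_l)] of a difference of
    square roots transfers the gain of [symbol_difference] to the roots. *)
Lemma root_difference rho Lambda mu m sigma c gamma N :
  weight_function Lambda mu -> symbol_class rho Lambda (2 * m) sigma -> 0 < gamma ->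
  (forall k x, N <= Rabs (IZR k) ->
     gamma * Rpower (Lambda k) (2 * m) <= shifted sigma c k x) ->
  exists P, forall n, exists K, 0 <= K /\ forall k l,
    N <= Rabs (IZR k) -> N <= Rabs (IZR l) ->
    CB n (root sigma c k) (K * Rpower (Lambda k) m) /\
    CB n (fun x => (root sigma c k x - root sigma c l x) *
                   (root sigma c k x - root sigma c l x))
         (K * Rpower (Lambda k) (m - rho) ^ 2 * jap (k - l) ^ P).
Proof.
  intros HW HS Hg Hlow.
  destruct (symbol_difference _ _ _ _ _ HW HS) as (P & HP).
  exists (P + P)%nat. intros n.
  destruct (HP n) as (K3 & HK3 & HD). clear HP.
  destruct (shifted_CB _ _ _ _ c HS n) as (K0 & HK0 & HA).
  assert (Hsg : 0 < sqrt gamma) by (apply sqrt_lt_R0; auto).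
  set (beta := fun k => sqrt gamma * Rpower (Lambda k) m).
  assert (Hbeta : forall k, 0 < beta k)
    by (intros k; apply Rmult_lt_0_compat; auto; apply Rpower_pos).
  assert (Hbeta2 : forall k, beta k ^ 2 = gamma * Rpower (Lambda k) (2 * m)).
  { intros k; unfold beta. rewrite Rpow_mult_distr, pow2_sqrt, Rpower_double by lra.
    reflexivity. }
  destruct (CB_sqrt n (K0 / gamma)) as (K1 & HK1).
  destruct (CB_inv n K1) as (K2 & HK2).
  set (D := 2 ^ n * ((1 + Rabs c) * K3 * (Rabs K2 / sqrt gamma))).
  assert (H2n : 0 < 2 ^ n) by (apply pow_lt; lra).
  pose proof (Rabs_pos c) as Hc.
  assert (HD0 : 0 <= D).
  { unfold D. apply Rmult_le_pos; [lra|]. apply Rmult_le_pos.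
    - apply Rmult_le_pos; lra.
    - apply Rle_mult_inv_pos; auto; apply Rabs_pos. }
  assert (HDD : 0 <= 2 ^ n * (D * D)) by (apply Rmult_le_pos; nra).
  assert (HK1s : 0 <= Rabs K1 * sqrt gamma)
    by (apply Rmult_le_pos; [apply Rabs_pos|lra]).
  exists (Rabs K1 * sqrt gamma + 2 ^ n * (D * D)).
  split; [lra|].
  assert (Hroot : forall k, N <= Rabs (IZR k) -> CB n (root sigma c k) (K1 * beta k)).
  { intros k Hk. apply HK1; auto.
    - intros x; rewrite Hbeta2; auto.
    - rewrite Hbeta2. eapply CB_le; [|apply (HA k)]. right; field; lra. }
  assert (Hge : forall k x, N <= Rabs (IZR k) -> beta k <= root sigma c k x).
  { intros k x Hk. rewrite <- (sqrt_pow2 (beta k)) by (left; auto).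
    apply sqrt_le_1_alt. rewrite Hbeta2; auto. }
  intros k l Hk Hl. split.
  - eapply CB_le; [|apply (Hroot k Hk)]. unfold beta.
    generalize (Rpower_pos (Lambda k) m) (Rle_abs K1); intros HR HK1'.
    assert (K1 * sqrt gamma <= Rabs K1 * sqrt gamma) by (apply Rmult_le_compat_r; lra).
    nra.
  - assert (Hinv : CB n (fun x => / (root sigma c k x + root sigma c l x))
                     (Rabs K2 * / beta k)).
    { eapply CB_le; [|apply (HK2 _ (beta k + beta l))].
      - assert (Hi : / (beta k + beta l) <= / beta k)
          by (apply Rinv_le_contravar; auto; generalize (Hbeta l); lra).
        assert (Hi0 : 0 < / (beta k + beta l))
          by (apply Rinv_0_lt_compat; generalize (Hbeta k) (Hbeta l); lra).
        apply Rle_trans with (Rabs K2 * / (beta k + beta l)).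
        + apply Rmult_le_compat_r; [lra|apply Rle_abs].
        + apply Rmult_le_compat_l; [apply Rabs_pos|auto].
      - generalize (Hbeta k) (Hbeta l); lra.
      - intros x; generalize (Hge k x Hk) (Hge l x Hl); lra.
      - rewrite Rmult_plus_distr_l. apply CB_plus; auto. }
    set (E := K3 * Rpower (Lambda k) (2 * m - rho) * jap (k - l) ^ P).
    assert (Hdiff : CB n (fun x => shifted sigma c k x - shifted sigma c l x)
                      ((1 + Rabs c) * E)).
    { apply (CB_ext n (fun x => (Re (sigma k x) - Re (sigma l x)) -
                                c * (Re (sigma k 0) - Re (sigma l 0)))).
      { intros x; unfold shifted; ring. }
      eapply CB_le; [|apply CB_minus; [apply HD|apply CB_const]].
      fold E. rewrite Rabs_mult.
      assert (Rabs (Re (sigma k 0) - Re (sigma l 0)) <= E)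
        by apply (CB_bound _ _ _ 0 (HD k l)). nra. }
    assert (Hd : CB n (fun x => root sigma c k x - root sigma c l x)
                   (D * Rpower (Lambda k) (m - rho) * jap (k - l) ^ P)).
    { apply (CB_ext n (fun x => (shifted sigma c k x - shifted sigma c l x) *
                                / (root sigma c k x + root sigma c l x))).
      { intros x. generalize (Hge k x Hk) (Hge l x Hl) (Hbeta k) (Hbeta l).
        assert (Hsq : forall j, N <= Rabs (IZR j) ->
          shifted sigma c j x = root sigma c j x * root sigma c j x).
        { intros j Hj. unfold root. rewrite sqrt_sqrt; auto.
          eapply Rle_trans; [|apply Hlow; auto]. rewrite <- Hbeta2. apply pow2_ge_0. }
        rewrite (Hsq k Hk), (Hsq l Hl). intros. field. lra. }
      eapply CB_le; [|apply CB_mult; [exact Hdiff|exact Hinv]].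
      right. unfold E, D, beta.
      replace (2 * m - rho) with (m + (m - rho)) by ring. rewrite Rpower_plus.
      generalize (Rpower_pos (Lambda k) m); intros. field. lra. }
    eapply CB_le; [|apply CB_mult; [exact Hd|exact Hd]].
    rewrite pow_add.
    generalize (Rpower_pos (Lambda k) (m - rho)) (pow_lt _ P (jap_pos (k - l))).
    set (u := Rpower (Lambda k) (m - rho)). set (J := jap (k - l) ^ P). intros Hu HJ.
    replace (2 ^ n * (D * u * J * (D * u * J))) with (2 ^ n * (D * D) * (u ^ 2 * (J * J)))
      by ring.
    rewrite (Rmult_assoc _ (u ^ 2)). apply Rmult_le_compat_r; [|lra].
    apply Rmult_le_pos; [apply pow2_ge_0|nra].
Qed.

(** * The quadratic form *)

(** The real part of [f l e^(-ilx)] times the conjugate of [f k e^(-ikx)]. *)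
Definition cross (f : Z -> C) (k l : Z) (x : R) : R :=
  trig (Re (f l * Cconj (f k))%C) (- Im (f l * Cconj (f k))%C) (k - l) x.

Definition form (sigma : Z -> R -> C) (f : Z -> C) (k l : Z) : R :=
  Re (f l * Cconj (f k) * kern sigma k l)%C.

Lemma cross_eq f k l x : cross f k l x =
  trig (Re (f k)) (Im (f k)) k x * trig (Re (f l)) (Im (f l)) l x +
  trig (Im (f k)) (- Re (f k)) k x * trig (Im (f l)) (- Re (f l)) l x.
Proof.
  unfold cross, trig. rewrite minus_IZR, Rmult_minus_distr_r, cos_minus, sin_minus.
  unfold Re, Im; simpl. ring.
Qed.

Lemma cross_sym f k l x : cross f k l x = cross f l k x.
Proof. rewrite !cross_eq; ring. Qed.

Lemma continuous_cross f k l x : continuous (cross f k l) x.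
Proof. apply continuous_trig. Qed.

Lemma mean_cross f k l :
  mean (cross f k l) = if Z.eq_dec k l then Cmod (f k) ^ 2 else 0.
Proof.
  destruct (Z.eq_dec k l) as [<-|Hkl].
  - rewrite (mean_ext _ (fun _ => Cmod (f k) ^ 2)).
    + unfold mean. rewrite (RInt_const (V := R_CompleteNormedModule)).
      unfold scal; simpl; unfold mult; simpl. field. apply PI_neq0.
    + intros x; unfold cross, trig. rewrite Z.sub_diag, Rmult_0_l, cos_0, sin_0.
      rewrite <- Cmod2_conj. unfold Re, Im; simpl. ring.
  - apply mean_trig_0. lia.
Qed.

Lemma Cmod_mult_conj (z w : C) : Cmod (z * Cconj w)%C = Cmod z * Cmod w.
Proof. now rewrite Cmod_mult, Cmod_conj. Qed.

Lemma SZ_continuous N (F : Z -> R -> R) x :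
  (forall k, continuous (F k) x) -> continuous (fun y => SZ N (fun k => F k y)) x.
Proof.
  intros H; induction N as [|N IH]; cbn [SZ].
  - apply continuous_const.
  - apply continuous_Rplus; auto. apply continuous_Rplus; auto.
Qed.

Lemma mean_SZ N (F : Z -> R -> R) : (forall k x, continuous (F k) x) ->
  mean (fun x => SZ N (fun k => F k x)) = SZ N (fun k => mean (F k)).
Proof.
  intros H; induction N as [|N IH]; cbn [SZ].
  - unfold mean. rewrite (RInt_const (V := R_CompleteNormedModule)).
    unfold scal; simpl; unfold mult; simpl. field. apply PI_neq0.
  - rewrite !mean_plus, IH; auto using SZ_continuous.
    intros x; apply continuous_Rplus; auto.
Qed.

(** The kernel [cross f k l * (b k * b l)] sums to the squared modulus of the
    sum of the [f k e^(-ikx) b k]. *)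
Lemma square_form_nonneg N f (b : Z -> R -> R) : (forall k x, continuous (b k) x) ->
  0 <= SZ N (fun k => SZ N (fun l => mean (fun x => cross f k l x * (b k x * b l x)))).
Proof.
  intros Hb.
  assert (Hc : forall k l x, continuous (fun x => cross f k l x * (b k x * b l x)) x)
    by (intros; apply continuous_Rmult; [apply continuous_cross|apply continuous_Rmult; auto]).
  rewrite (SZ_ext N _ (fun k => mean (fun x => SZ N (fun l =>
             cross f k l x * (b k x * b l x)))))
    by (intros k; rewrite mean_SZ; auto).
  rewrite <- (mean_SZ N (fun k x => SZ N (fun l => cross f k l x * (b k x * b l x))))
    by (intros; apply SZ_continuous; auto).
  apply mean_nonneg.
  - intros x; apply (SZ_continuous N (fun k x => SZ N (fun l => _))).
    intros k; apply SZ_continuous; auto.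
  - intros x.
    set (u := fun k => trig (Re (f k)) (Im (f k)) k x * b k x).
    set (v := fun k => trig (Im (f k)) (- Re (f k)) k x * b k x).
    rewrite (SZ_ext N _ (fun k => SZ N (fun l => u k * u l) + SZ N (fun l => v k * v l))).
    + rewrite SZ_plus, !SZ_sq. nra.
    + intros k. rewrite <- SZ_plus. apply SZ_ext; intros l.
      rewrite cross_eq; unfold u, v; ring.
Qed.

Lemma form_real sigma f k l : cont_symbol sigma -> (forall x, Im (sigma k x) = 0) ->
  form sigma f k l = mean (fun x => cross f k l x * Re (sigma k x)).
Proof.
  intros Hc Hi. unfold form. rewrite kern_Re by auto.
  rewrite (mean_ext (fun x => trig (Im _) _ _ x * Im (sigma k x))
             (fun x => 0 * cross f k l x)) by (intros x; rewrite Hi; ring).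
  rewrite mean_scal by apply continuous_cross. unfold cross. ring.
Qed.

(** Since [sigma_k + sigma_l = 2 b_k b_l + (b_k - b_l)^2 + d_k + d_l], with
    [d] independent of [x], the symmetrised entry differs from that of a
    nonnegative form by a diagonal term and by the error [(b_k - b_l)^2]. *)
Lemma form_good rho Lambda mu m sigma c kappa gamma N :
  weight_function Lambda mu -> symbol_class rho Lambda (2 * m) sigma ->
  0 < gamma -> 0 < c ->
  (forall k x, N <= Rabs (IZR k) ->
     Im (sigma k x) = 0 /\ kappa * Rpower (Lambda k) (2 * m) <= Re (sigma k x)) ->
  (forall k x, N <= Rabs (IZR k) ->
     gamma * Rpower (Lambda k) (2 * m) <= shifted sigma c k x) ->
  exists K, 0 <= K /\ forall f k l, N <= Rabs (IZR k) -> N <= Rabs (IZR l) ->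
    2 * mean (fun x => cross f k l x * (root sigma c k x * root sigma c l x))
    + (if Z.eq_dec k l
       then 2 * (c * kappa) * (Rpower (Lambda k) (2 * m) * Cmod (f k) ^ 2) else 0)
    <= form sigma f k l + form sigma f l k
       + K * (/ jap (k - l) ^ 2 * (Rpower (Lambda k) (m - rho) * Cmod (f k)
                                   * (Rpower (Lambda l) (m - rho) * Cmod (f l)))).
Proof.
  intros HW HS Hg Hc Hgood Hlow.
  pose proof (symbol_cont _ _ _ _ HS) as Hcont. pose proof HS as (Hper & _).
  destruct (root_difference _ _ _ _ _ c gamma N HW HS Hg Hlow) as (P & HP).
  destruct (weight_Peetre _ _ HW (m - rho)) as (K1 & Q & HK1 & HQ).
  (* [P] powers of the bracket pay for [root_difference], [Q] for moving one half
     of the weight from [k] to [l], and 2 are left for Schur's test. *)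
  set (M := (P + (Q + 2))%nat).
  destruct (HP (S M)) as (K2 & HK2 & HR). clear HP.
  assert (H2M : 0 < 2 ^ M) by (apply pow_lt; lra).
  exists (2 ^ M * 2 * K2 * K1). split.
  { repeat apply Rmult_le_pos; lra. }
  intros f k l Hk Hl.
  destruct (HR k l Hk Hl) as [Hrk Hq]. destruct (HR l k Hl Hk) as [Hrl _].
  set (bk := root sigma c k) in *. set (bl := root sigma c l) in *.
  assert (Hbk : forall x, continuous bk x) by (intros x; apply (CB_continuous _ _ _ x Hrk)).
  assert (Hbl : forall x, continuous bl x) by (intros x; apply (CB_continuous _ _ _ x Hrl)).
  set (q := fun x => (bk x - bl x) * (bk x - bl x)).
  assert (Hqc : forall x, continuous q x) by (intros x; apply (CB_continuous _ _ _ x Hq)).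
  pose proof (continuous_cross f k l) as Hx.
  rewrite (form_real sigma f k l Hcont (fun x => proj1 (Hgood k x Hk))).
  rewrite (form_real sigma f l k Hcont (fun x => proj1 (Hgood l x Hl))).
  set (d := c * Re (sigma k 0) + c * Re (sigma l 0)).
  assert (Hsq : forall j x, N <= Rabs (IZR j) ->
    Re (sigma j x) = root sigma c j x * root sigma c j x + c * Re (sigma j 0)).
  { intros j x Hj. unfold root. rewrite sqrt_sqrt; [unfold shifted; ring|].
    eapply Rle_trans; [|apply Hlow; auto].
    generalize (Rpower_pos (Lambda j) (2 * m)); nra. }
  rewrite <- (mean_plus (fun x => cross f k l x * Re (sigma k x))
                        (fun x => cross f l k x * Re (sigma l x))).
  2:{ intros x; apply continuous_Rmult; auto; apply Hcont. }
  2:{ intros x; apply continuous_Rmult; [apply continuous_cross|apply Hcont]. }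
  rewrite (mean_ext
    (fun x => cross f k l x * Re (sigma k x) + cross f l k x * Re (sigma l x))
    (fun x => (2 * (cross f k l x * (bk x * bl x)) + cross f k l x * q x)
                                + d * cross f k l x)).
  2:{ intros x. rewrite (cross_sym f l k), (Hsq k x Hk), (Hsq l x Hl).
      unfold q, d; fold bk bl; ring. }
  assert (Hm1 : forall x, continuous (fun x => cross f k l x * (bk x * bl x)) x)
    by (intros; apply continuous_Rmult; auto; apply continuous_Rmult; auto).
  assert (Hm2 : forall x, continuous (fun x => cross f k l x * q x) x)
    by (intros; apply continuous_Rmult; auto).
  assert (Hcm : forall a (g : R -> R), (forall x, continuous g x) ->
     forall x, continuous (fun x => a * g x) x).
  { intros a g G x. apply continuous_Rmult; auto. apply continuous_const. }
  rewrite (mean_plus _ (fun x => d * cross f k l x)); auto.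
  2:{ intros x; apply continuous_Rplus; auto. }
  rewrite mean_plus, !mean_scal; auto.
  assert (Hdiag : (if Z.eq_dec k l
       then 2 * (c * kappa) * (Rpower (Lambda k) (2 * m) * Cmod (f k) ^ 2) else 0)
       <= d * mean (cross f k l)).
  { rewrite mean_cross. destruct (Z.eq_dec k l) as [E|E]; [|lra].
    unfold d. rewrite <- E.
    replace (2 * (c * kappa) * (Rpower (Lambda k) (2 * m) * Cmod (f k) ^ 2))
      with (2 * c * (kappa * Rpower (Lambda k) (2 * m)) * Cmod (f k) ^ 2) by ring.
    apply Rmult_le_compat_r; [apply pow2_ge_0|].
    destruct (Hgood k 0 Hk) as [_ H]. nra. }
  assert (Herr : Rabs (mean (fun x => cross f k l x * q x)) <=
    2 ^ M * 2 * K2 * K1 * (/ jap (k - l) ^ 2 * (Rpower (Lambda k) (m - rho) * Cmod (f k)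
                                   * (Rpower (Lambda l) (m - rho) * Cmod (f l))))).
  { assert (Hqper : per q).
    { intros x; unfold q, bk, bl, root, shifted. now rewrite !Hper. }
    unfold cross. eapply Rle_trans; [apply (Fourier_decay M _ _ _ q _ Hqper Hq)|].
    rewrite Rabs_Ropp.
    destruct (Cmod_Re_Im (f l * Cconj (f k))%C) as [Hz1 Hz2].
    rewrite Cmod_mult_conj in Hz1, Hz2.
    specialize (HQ l k). rewrite (jap_sym l k) in HQ.
    revert HQ. set (u := Rpower (Lambda k) (m - rho)). set (w := Rpower (Lambda l) (m - rho)).
    assert (Hu : 0 < u) by apply Rpower_pos. assert (Hw : 0 < w) by apply Rpower_pos.
    pose proof (jap_pos (k - l)) as HJ. set (J := jap (k - l)) in *.
    pose proof (pow_lt _ P HJ) as HJP. pose proof (pow_lt _ Q HJ) as HJQ.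
    unfold M; rewrite !pow_add. fold M. intros HQ.
    pose proof (Cmod_ge_0 (f k)) as Hfk. pose proof (Cmod_ge_0 (f l)) as Hfl.
    set (Z1 := Rabs (Re (f l * Cconj (f k))%C)) in *.
    set (Z2 := Rabs (Im (f l * Cconj (f k))%C)) in *.
    assert (H2 : 2 ^ P * (2 ^ Q * 2 ^ 2) = 2 ^ M) by (unfold M; rewrite !pow_add; ring).
    rewrite H2.
    replace (2 ^ M * (Z1 + Z2) * (K2 * u ^ 2 * J ^ P) / (J ^ P * (J ^ Q * J ^ 2)))
      with (2 ^ M * K2 * u / (J ^ Q * J ^ 2) * ((Z1 + Z2) * u)) by (field; lra).
    apply Rle_trans with (2 ^ M * K2 * u / (J ^ Q * J ^ 2) *
       ((2 * (Cmod (f l) * Cmod (f k))) * (K1 * w * J ^ Q))).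
    - apply Rmult_le_compat_l.
      + apply Rle_mult_inv_pos; [|apply Rmult_lt_0_compat; auto; apply pow_lt; auto].
        repeat apply Rmult_le_pos; lra.
      + apply Rmult_le_compat; try lra.
        apply Rplus_le_le_0_compat; apply Rabs_pos.
    - right. field. lra. }
  apply Rabs_le_between in Herr. lra.
Qed.

Lemma weight_bounded_region Lambda mu N s t : weight_function Lambda mu ->
  exists K, 0 < K /\ forall k, Rabs (IZR k) < N ->
    Rpower (Lambda k) s <= K * Rpower (Lambda k) t.
Proof.
  intros HW. destruct (weight_Peetre _ _ HW (s - t)) as (K & P & HK & HP).
  destruct (Rle_lt_dec N 0) as [HN|HN].
  { exists 1; split; [lra|]. intros k Hk. generalize (Rabs_pos (IZR k)); lra. }
  exists (K * Rpower (Lambda 0%Z) (s - t) * (1 + N) ^ P). split.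
  { repeat apply Rmult_lt_0_compat; auto using Rpower_pos. apply pow_lt; lra. }
  intros k Hk. replace s with ((s - t) + t) at 1 by ring. rewrite Rpower_plus.
  apply Rmult_le_compat_r; [left; apply Rpower_pos|].
  eapply Rle_trans; [apply (HP 0%Z k)|].
  apply Rmult_le_compat_l.
  - left; apply Rmult_lt_0_compat; auto using Rpower_pos.
  - apply pow_incr. split; [left; apply jap_pos|].
    rewrite jap_sym, Z.sub_0_r. unfold jap; lra.
Qed.

(** Entries with an index in a bounded region are as small as the error terms
    of [form_good]: there all powers of the weight are comparable, and the decay
    of the matrix pays for passing from one index to the other. *)
Lemma form_bad rho Lambda mu m sigma N :
  weight_function Lambda mu -> symbol_class rho Lambda (2 * m) sigma ->
  exists K, 0 <= K /\ forall f k l, Rabs (IZR k) < N \/ Rabs (IZR l) < N ->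
    Rabs (form sigma f k l) <=
    K * (/ jap (k - l) ^ 2 * (Rpower (Lambda k) (m - rho) * Cmod (f k)
                              * (Rpower (Lambda l) (m - rho) * Cmod (f l)))).
Proof.
  intros HW HS.
  destruct (weight_Peetre _ _ HW (m - rho)) as (K1 & Q1 & HK1 & HQ1).
  destruct (weight_Peetre _ _ HW (2 * m)) as (K2 & Q2 & HK2 & HQ2).
  destruct (weight_bounded_region _ _ N (2 * m) (2 * (m - rho)) HW) as (K3 & HK3 & HB).
  destruct (kern_decay _ _ _ _ HS (Q1 + (Q2 + 2))) as (K & HK & HM).
  exists (K * (K3 * K1 + K2 * K3 * K1)). split.
  { assert (0 <= K3 * K1) by (apply Rmult_le_pos; lra).
    assert (0 <= K2 * K3 * K1) by (repeat apply Rmult_le_pos; lra). nra. }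
  intros f k l Hbad. unfold form.
  eapply Rle_trans; [apply HM|]. rewrite Cmod_mult_conj.
  pose proof (jap_ge_1 (k - l)) as HJ1. pose proof (jap_pos (k - l)) as HJ.
  specialize (HQ1 l k) as HQ1'. specialize (HQ1 k l). specialize (HQ2 l k).
  rewrite (jap_sym l k) in HQ1', HQ2.
  set (J := jap (k - l)) in *.
  set (u := Rpower (Lambda k) (m - rho)) in *. set (w := Rpower (Lambda l) (m - rho)) in *.
  assert (Hu : 0 < u) by apply Rpower_pos. assert (Hw : 0 < w) by apply Rpower_pos.
  pose proof (pow_lt _ Q1 HJ) as HJ1'. pose proof (pow_lt _ Q2 HJ) as HJ2.
  assert (HJge : 1 <= J ^ Q2) by (apply pow_R1_Rle; auto).
  assert (Hmain : Rpower (Lambda k) (2 * m) <=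
     (K3 * K1 + K2 * K3 * K1) * (u * w) * (J ^ Q1 * J ^ Q2)).
  { assert (Huw : 0 < u * w) by (apply Rmult_lt_0_compat; auto).
    assert (H31 : 0 < K3 * K1) by (apply Rmult_lt_0_compat; auto).
    assert (H231 : 0 < K2 * K3 * K1) by (repeat apply Rmult_lt_0_compat; auto).
    assert (HJJ : 0 < J ^ Q1 * J ^ Q2) by (apply Rmult_lt_0_compat; auto).
    destruct Hbad as [Hb|Hb]; specialize (HB _ Hb); rewrite (Rpower_double _ (m - rho)) in HB.
    - fold u in HB.
      apply Rle_trans with (K3 * K1 * (u * w) * (J ^ Q1 * J ^ Q2)).
      + eapply Rle_trans; [exact HB|].
        apply Rle_trans with (K3 * (u * (K1 * w * J ^ Q1))).
        * apply Rmult_le_compat_l; [lra|]. simpl; rewrite Rmult_1_r.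
          apply Rmult_le_compat_l; lra.
        * replace (K3 * (u * (K1 * w * J ^ Q1))) with (K3 * K1 * (u * w) * J ^ Q1 * 1) by ring.
          replace (K3 * K1 * (u * w) * (J ^ Q1 * J ^ Q2))
            with (K3 * K1 * (u * w) * J ^ Q1 * J ^ Q2) by ring.
          apply Rmult_le_compat_l; auto. left; repeat apply Rmult_lt_0_compat; auto.
      + apply Rmult_le_compat_r; [lra|]. apply Rmult_le_compat_r; lra.
    - fold w in HB.
      apply Rle_trans with (K2 * K3 * K1 * (u * w) * (J ^ Q1 * J ^ Q2)).
      + eapply Rle_trans; [exact HQ2|].
        apply Rle_trans with (K2 * (K3 * (w * (K1 * u * J ^ Q1))) * J ^ Q2).
        * apply Rmult_le_compat_r; [lra|]. apply Rmult_le_compat_l; [lra|].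
          eapply Rle_trans; [exact HB|]. apply Rmult_le_compat_l; [lra|].
          simpl; rewrite Rmult_1_r. apply Rmult_le_compat_l; lra.
        * right; ring.
      + apply Rmult_le_compat_r; [lra|]. apply Rmult_le_compat_r; lra. }
  rewrite !pow_add.
  pose proof (Cmod_ge_0 (f k)) as Hfk. pose proof (Cmod_ge_0 (f l)) as Hfl.
  set (X := K3 * K1 + K2 * K3 * K1) in *. set (Y := Rpower (Lambda k) (2 * m)) in *.
  set (g := / (J ^ Q1 * (J ^ Q2 * J ^ 2))).
  assert (HJ2' : 0 < J ^ 2) by (apply pow_lt; auto).
  assert (Hg : 0 < g) by (apply Rinv_0_lt_compat, Rmult_lt_0_compat; auto; apply Rmult_lt_0_compat; auto).
  apply Rle_trans with (K * (Cmod (f l) * Cmod (f k)) * (X * (u * w) * (J ^ Q1 * J ^ Q2)) * g).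
  - unfold Rdiv; fold g. apply Rmult_le_compat_r; [lra|]. apply Rmult_le_compat_l; auto.
    repeat apply Rmult_le_pos; lra.
  - right. unfold g. field. lra.
Qed.

(** * Garding's inequality *)

(** For a finite square of indices, the pairwise bounds [form_good] and
    [form_bad] are added up; [b] vanishes at the indices where the symbol need
    not have a real square root, so the square still runs over all indices. *)
Lemma form_lower_bound rho Lambda mu m sigma :
  weight_function Lambda mu -> symbol_class rho Lambda (2 * m) sigma ->
  M_elliptic Lambda (2 * m) sigma ->
  cofinitely_many (fun k : Z => forall x : R, Cnonneg (sigma k x)) ->
  exists C K, 0 < C /\ 0 <= K /\ forall f N,
    C * SZ N (fun k => Rpower (Lambda k) (2 * m) * Cmod (f k) ^ 2)
    <= SZ N (fun k => SZ N (form sigma f k))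
       + K * SZ N (fun k => (Rpower (Lambda k) (m - rho) * Cmod (f k)) ^ 2).
Proof.
  intros HW HS HE Hcof.
  destruct (elliptic_tail _ _ _ HE Hcof) as (kappa & N & Hkap & Hgood).
  destruct (symbol_bounds _ _ _ _ HS 0%nat) as (K0 & HK0 & HB).
  (* [K0] bounds [Re sigma / Lambda ^ (2 m)], so [c Re sigma_k(0)] is at most half
     of the lower bound [kappa Lambda ^ (2 m)]. *)
  set (c := kappa / (2 * K0)).
  assert (Hc : 0 < c) by (apply Rdiv_lt_0_compat; lra).
  assert (Hlow : forall k x, N <= Rabs (IZR k) ->
     kappa / 2 * Rpower (Lambda k) (2 * m) <= shifted sigma c k x).
  { intros k x Hk. unfold shifted.
    destruct (Hgood k x Hk) as [_ H1].
    pose proof (CB_bound _ _ _ 0 (proj1 (HB k))) as H2. apply Rabs_le_between in H2.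
    assert (c * Re (sigma k 0) <= c * (K0 * Rpower (Lambda k) (2 * m)))
      by (apply Rmult_le_compat_l; lra).
    replace (c * (K0 * Rpower (Lambda k) (2 * m)))
      with (kappa / 2 * Rpower (Lambda k) (2 * m)) in * by (unfold c; field; lra).
    lra. }
  assert (Hkap2 : 0 < kappa / 2) by lra.
  destruct (form_good _ _ _ _ _ c kappa (kappa / 2) N HW HS Hkap2 Hc Hgood Hlow)
    as (K1 & HK1 & HG).
  destruct (form_bad _ _ _ _ _ N HW HS) as (K2 & HK2 & Hbad).
  destruct (weight_bounded_region _ _ N (2 * m) (2 * (m - rho)) HW) as (K3 & HK3 & HR).
  destruct (root_difference _ _ _ _ _ c _ N HW HS Hkap2 Hlow)
    as (P & HP).
  destruct (HP 1%nat) as (K4 & _ & HC). clear HP.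
  set (b := fun k x => if Rle_dec N (Rabs (IZR k)) then root sigma c k x else 0).
  assert (Hb : forall k x, continuous (b k) x).
  { intros k x; unfold b. destruct (Rle_dec N (Rabs (IZR k))) as [Hk|Hk].
    - apply (CB_continuous _ _ _ x (proj1 (HC k k Hk Hk))).
    - apply continuous_const. }
  assert (Hck : 0 < c * kappa) by (apply Rmult_lt_0_compat; auto).
  assert (HcK : 0 <= 2 * (c * kappa) * K3) by (apply Rmult_le_pos; lra).
  set (K := K1 + 2 * K2 + 2 * (c * kappa) * K3).
  exists (c * kappa), (2 * K). split; [auto|split; [unfold K; lra|]].
  intros f n. set (v := fun k => Rpower (Lambda k) (m - rho) * Cmod (f k)).
  assert (Hv : forall k, 0 <= v k).
  { intros k; apply Rmult_le_pos; [left; apply Rpower_pos|apply Cmod_ge_0]. }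
  assert (Hpair : forall k l,
    2 * mean (fun x => cross f k l x * (b k x * b l x))
    + (if Z.eq_dec k l
       then 2 * (c * kappa) * (Rpower (Lambda k) (2 * m) * Cmod (f k) ^ 2) else 0)
    <= form sigma f k l + form sigma f l k + K * (/ jap (k - l) ^ 2 * (v k * v l))).
  { intros k l.
    assert (Hw : 0 <= / jap (k - l) ^ 2 * (v k * v l)).
    { apply Rmult_le_pos; [|apply Rmult_le_pos; auto].
      left; apply Rinv_0_lt_compat, pow_lt, jap_pos. }
    assert (Hbadkl : Rabs (IZR k) < N \/ Rabs (IZR l) < N ->
      (forall x, b k x * b l x = 0) ->
      2 * mean (fun x => cross f k l x * (b k x * b l x))
      + (if Z.eq_dec k l
         then 2 * (c * kappa) * (Rpower (Lambda k) (2 * m) * Cmod (f k) ^ 2) else 0)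
      <= form sigma f k l + form sigma f l k + K * (/ jap (k - l) ^ 2 * (v k * v l))).
    { intros Hkl Hb0.
      rewrite (mean_ext _ (fun x => 0 * cross f k l x)) by (intros x; rewrite Hb0; ring).
      rewrite mean_scal by apply continuous_cross.
      pose proof (Hbad f k l Hkl) as H1.
      pose proof (Hbad f l k ltac:(tauto)) as H2.
      rewrite (jap_sym l k) in H2.
      fold (v k) (v l) in H1, H2. rewrite (Rmult_comm (v l)) in H2.
      apply Rabs_le_between in H1. apply Rabs_le_between in H2.
      set (W := / jap (k - l) ^ 2 * (v k * v l)) in *.
      assert (H3 : (if Z.eq_dec k l
         then 2 * (c * kappa) * (Rpower (Lambda k) (2 * m) * Cmod (f k) ^ 2) else 0)
         <= 2 * (c * kappa) * K3 * W).
      { destruct (Z.eq_dec k l) as [Ekl|Ekl]; [|apply Rmult_le_pos; lra].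
        assert (Hk : Rabs (IZR k) < N) by (destruct Hkl; subst; auto).
        specialize (HR k Hk). rewrite (Rpower_double _ (m - rho)) in HR.
        unfold W. rewrite <- Ekl, Z.sub_diag. unfold jap. rewrite Rabs_R0.
        replace (/ (1 + 0) ^ 2 * (v k * v k)) with (v k ^ 2) by (field; lra).
        unfold v. rewrite Rpow_mult_distr, <- Rmult_assoc, (Rmult_assoc _ K3).
        rewrite <- (Rmult_assoc K3).
        rewrite Rmult_assoc. apply Rmult_le_compat_l; [lra|].
        apply Rmult_le_compat_r; [apply pow2_ge_0|auto]. }
      assert (0 <= K1 * W) by (apply Rmult_le_pos; auto).
      unfold K. lra. }
    unfold b in *.
    destruct (Rle_dec N (Rabs (IZR k))) as [Hk|Hk];
      [destruct (Rle_dec N (Rabs (IZR l))) as [Hl|Hl]|].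
    - eapply Rle_trans; [apply (HG f k l Hk Hl)|].
      fold (v k) (v l). apply Rplus_le_compat_l, Rmult_le_compat_r; auto.
      unfold K; lra.
    - apply Hbadkl; [right; lra|]. intros; ring.
    - apply Hbadkl; [left; lra|]. intros; ring. }
  assert (Hsum := SZ_le n _ _ (fun k => SZ_le n _ _ (Hpair k))).
  rewrite (SZ_ext n (fun k => SZ n (fun l => 2 * _ + _))
    (fun k => 2 * SZ n (fun l => mean (fun x => cross f k l x * (b k x * b l x))) +
       SZ n (fun l => if Z.eq_dec k l
       then 2 * (c * kappa) * (Rpower (Lambda k) (2 * m) * Cmod (f k) ^ 2) else 0))) in Hsum
    by (intros k; rewrite SZ_plus, SZ_scal; reflexivity).
  rewrite SZ_plus, SZ_scal in Hsum.
  rewrite (SZ_diag n (fun k => 2 * (c * kappa) *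
            (Rpower (Lambda k) (2 * m) * Cmod (f k) ^ 2))), SZ_scal in Hsum.
  rewrite (SZ_ext n (fun k => SZ n (fun l => _ + _ + _))
    (fun k => SZ n (form sigma f k) + SZ n (fun l => form sigma f l k) +
       K * SZ n (fun l => / jap (k - l) ^ 2 * (v k * v l)))) in Hsum
    by (intros k; rewrite !SZ_plus, SZ_scal; reflexivity).
  rewrite !SZ_plus, SZ_scal in Hsum.
  rewrite (SZ_swap n n (fun k l => form sigma f l k)) in Hsum.
  change (SZ n (fun l => SZ n (fun k => form sigma f l k)))
    with (SZ n (fun k => SZ n (form sigma f k))) in Hsum.
  pose proof (square_form_nonneg n f b Hb) as Hsq.
  pose proof (SZ_schur n v) as Hsch.
  assert (HK : 0 <= K) by (unfold K; lra).
  apply (Rmult_le_compat_l K) in Hsch; auto.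
  unfold v in *. lra.
Qed.

(** The weight [Lambda k ^ (2 m)] of row [k] is shared evenly between row and
    column, which is the form that Schur's test needs. *)
Lemma kern_bound rho Lambda mu m sigma :
  weight_function Lambda mu -> symbol_class rho Lambda (2 * m) sigma ->
  exists K, 0 < K /\ forall k l (z : C),
    Rabs (Re (z * kern sigma k l)%C) <=
    K * Cmod z * (/ jap (k - l) ^ 2 * (Rpower (Lambda k) m * Rpower (Lambda l) m)).
Proof.
  intros HW HS.
  destruct (weight_Peetre _ _ HW m) as (K1 & Q & HK1 & HQ).
  destruct (kern_decay _ _ _ _ HS (Q + 2)) as (K2 & HK2 & HM).
  exists (K2 * K1). split; [apply Rmult_lt_0_compat; auto|].
  intros k l z. eapply Rle_trans; [apply HM|].
  specialize (HQ l k). rewrite (jap_sym l k) in HQ.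
  pose proof (jap_pos (k - l)) as HJ. rewrite pow_add, Rpower_double.
  set (J := jap (k - l)) in *. set (u := Rpower (Lambda k) m) in *.
  set (w := Rpower (Lambda l) m) in *.
  assert (Hu : 0 < u) by apply Rpower_pos.
  pose proof (pow_lt _ Q HJ) as HJQ. pose proof (pow_lt _ 2 HJ) as HJ2.
  pose proof (Cmod_ge_0 z) as Hz.
  apply Rle_trans with (K2 * Cmod z * (u * (K1 * w * J ^ Q)) * / (J ^ Q * J ^ 2)).
  - unfold Rdiv. apply Rmult_le_compat_r.
    { left; apply Rinv_0_lt_compat, Rmult_lt_0_compat; auto. }
    apply Rmult_le_compat_l; [apply Rmult_le_pos; lra|].
    simpl; rewrite Rmult_1_r. apply Rmult_le_compat_l; lra.
  - right. field. lra.
Qed.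

(** Each row defining [T_op sigma f k], and then the double series, converges
    absolutely; so the iterated sum in the pairing is the limit of the sums over
    squares. *)
Lemma pairing_lim rho Lambda mu m sigma f :
  weight_function Lambda mu -> symbol_class rho Lambda (2 * m) sigma ->
  in_l2w Lambda m f ->
  is_lim_seq (fun N => SZ N (fun k => SZ N (form sigma f k)))
    (Re (l2_pairing (T_op sigma f) f)).
Proof.
  intros HW HS Hf.
  destruct (kern_bound _ _ _ _ _ HW HS) as (K & HK & HB).
  set (u := fun k => Rpower (Lambda k) m * Cmod (f k)).
  assert (Hu : forall k, 0 <= u k).
  { intros k; apply Rmult_le_pos; [left; apply Rpower_pos|apply Cmod_ge_0]. }
  assert (Hu2 : forall k, u k ^ 2 = Rpower (Lambda k) (2 * m) * Cmod (f k) ^ 2).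
  { intros k; unfold u. now rewrite Rpow_mult_distr, Rpower_double. }
  set (U := sumZ (fun k => Rpower (Lambda k) (2 * m) * Cmod (f k) ^ 2)).
  assert (HU : forall N, SZ N (fun k => u k ^ 2) <= U).
  { intros N. rewrite (SZ_ext N _ _ Hu2). apply SZ_le_sumZ; auto.
    intros k; rewrite <- Hu2; apply pow2_ge_0. }
  assert (Hj : forall n, 0 < / jap n ^ 2 <= 1).
  { intros n. split; [apply Rinv_0_lt_compat, pow_lt, jap_pos|].
    rewrite <- Rinv_1. apply Rinv_le_contravar; [lra|].
    apply pow_R1_Rle, jap_ge_1. }
  (* Both [f] and [- i f] are needed as [z], for the real and imaginary parts. *)
  assert (Hrow : forall k (z : Z -> C), (forall l, Cmod (z l) = Cmod (f l)) ->
            ex_sumZ (fun l => Re (z l * kern sigma k l)%C)).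
  { intros k z Hz.
    apply (ex_sumZ_bounded _ (K * Rpower (Lambda k) m * (4 + U))). intros N.
    assert (HKk : 0 < K * Rpower (Lambda k) m)
      by (apply Rmult_lt_0_compat; auto using Rpower_pos).
    apply Rle_trans with (K * Rpower (Lambda k) m *
      SZ N (fun l => / jap (l - k) ^ 2 + u l ^ 2)).
    - rewrite <- SZ_scal. apply SZ_le; intros l.
      eapply Rle_trans; [apply HB|]. rewrite Hz, (jap_sym k l).
      specialize (Hj (l - k)%Z). specialize (Hu l).
      replace (K * Cmod (f l) * (/ jap (l - k) ^ 2 *
                (Rpower (Lambda k) m * Rpower (Lambda l) m)))
        with (K * Rpower (Lambda k) m * (/ jap (l - k) ^ 2 * u l)) by (unfold u; ring).
      apply Rmult_le_compat_l; [lra|].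
      generalize (pow2_ge_0 (u l - 1)). intros; nra.
    - apply Rmult_le_compat_l; [lra|]. rewrite SZ_plus.
      generalize (SZ_jap N k) (HU N); lra. }
  assert (Hform : forall k, sumZ (form sigma f k) = Re (T_op sigma f k * Cconj (f k))%C).
  { intros k.
    rewrite (sumZ_ext _ (fun l => Re (f l * kern sigma k l)%C * Re (f k) +
                                  Im (f l * kern sigma k l)%C * Im (f k)))
      by (intros l; unfold form, Re, Im; simpl; ring).
    rewrite sumZ_comb.
    - change (T_op sigma f k) with (CsumZ (fun l => f l * kern sigma k l)%C).
      unfold CsumZ, Cconj, Cmult, Re, Im; simpl. ring.
    - apply Hrow; auto.
    - apply (ex_sumZ_ext (fun l => Re ((Im (f l), (- Re (f l))%R) * kern sigma k l)%C)).
      + intros l; now rewrite kern_Im.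
      + apply Hrow. intros l. unfold Cmod, Re, Im; simpl. f_equal; ring. }
  change (Re (l2_pairing (T_op sigma f) f)) with
    (sumZ (fun k => Re (T_op sigma f k * Cconj (f k))%C)).
  rewrite <- (sumZ_ext _ _ Hform).
  apply (sumZ_sumZ_lim _ (K * (4 * U))). intros N.
  apply Rle_trans with (K * SZ N (fun k => SZ N (fun l =>
     / jap (k - l) ^ 2 * (u k * u l)))).
  - rewrite <- SZ_scal. apply SZ_le; intros k. rewrite <- SZ_scal. apply SZ_le; intros l.
    unfold form. eapply Rle_trans; [apply HB|]. rewrite Cmod_mult_conj.
    right; unfold u; ring.
  - apply Rmult_le_compat_l; [lra|]. eapply Rle_trans; [apply SZ_schur|].
    generalize (HU N); lra.
Qed.

Theorem theorem5p3 :
  forall (Lambda : Z -> R) (mu rho : R),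
    weight_function Lambda mu ->
    0 < rho -> rho <= 1 / mu ->
    forall (m : R) (sigma : Z -> R -> C),
      0 < m ->
      symbol_class rho Lambda (2 * m) sigma ->
      M_elliptic Lambda (2 * m) sigma ->
      cofinitely_many (fun k : Z => forall x : R, Cnonneg (sigma k x)) ->
      exists C0 C1 : R, 0 < C0 /\ 0 < C1 /\
        forall f : Z -> C,
          in_l2w Lambda m f ->
          Re (l2_pairing (T_op sigma f) f)
          >= C0 * l2w_norm Lambda m f ^ 2 - C1 * l2_norm f ^ 2.
Proof.
  intros Lambda mu rho HW Hrho _ m sigma Hm HS HE Hcof.
  destruct (form_lower_bound _ _ _ _ _ HW HS HE Hcof) as (A & K & HA0 & HK & HF).
  (* With this [eps] the error takes at most half of the main term. *)
  set (eps := A / (2 * (K + 1))).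
  assert (Heps : 0 < eps) by (apply Rdiv_lt_0_compat; lra).
  assert (HKeps : K * eps <= A / 2).
  { replace (A / 2) with ((K + 1) * eps) by (unfold eps; field; lra). nra. }
  destruct (weight_absorb _ _ (2 * m) (2 * rho) eps HW ltac:(lra) Heps) as (D & HD & HA).
  exists (A / 2), (K * D + 1).
  assert (HKD : 0 <= K * D) by (apply Rmult_le_pos; lra).
  split; [lra|split; [lra|]]. intros f Hf.
  set (g := fun k => Rpower (Lambda k) (2 * m) * Cmod (f k) ^ 2).
  set (h := fun k => Cmod (f k) ^ 2).
  assert (Hg : forall k, 0 <= g k)
    by (intros k; apply Rmult_le_pos; [left; apply Rpower_pos|apply pow2_ge_0]).
  assert (Hh : forall k, 0 <= h k) by (intros k; apply pow2_ge_0).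
  assert (Hgs : ex_sumZ g) by exact Hf.
  assert (Hhs : ex_sumZ h).
  { destruct (weight_lower _ _ HW) as (c & Hc & Hlow).
    pose proof (Rpower_pos c (2 * m)) as Hcm.
    assert (Hle : forall k, h k <= / Rpower c (2 * m) * g k).
    { intros k. apply Rmult_le_reg_l with (Rpower c (2 * m)); auto.
      rewrite <- Rmult_assoc, Rinv_r, Rmult_1_l by lra.
      apply Rmult_le_compat_r; [apply Hh|]. apply Rle_Rpower_l; [lra|split; auto]. }
    apply (ex_sumZ_bounded _ (/ Rpower c (2 * m) * sumZ g)). intros N.
    apply Rle_trans with (/ Rpower c (2 * m) * SZ N g).
    - rewrite <- SZ_scal. apply SZ_le; intros k. rewrite Rabs_pos_eq; auto.
    - apply Rmult_le_compat_l; [left; apply Rinv_0_lt_compat; auto|].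
      apply SZ_le_sumZ; auto. }
  assert (Hn1 : l2w_norm Lambda m f ^ 2 = sumZ g)
    by (apply pow2_sqrt, sumZ_nonneg; auto).
  assert (Hn2 : l2_norm f ^ 2 = sumZ h)
    by (apply pow2_sqrt, sumZ_nonneg; auto).
  rewrite Hn1, Hn2. apply Rle_ge.
  assert (Hfin : forall N, A / 2 * SZ N g - (K * D + 1) * SZ N h
                           <= SZ N (fun k => SZ N (form sigma f k))).
  { intros N. specialize (HF f N). fold g in HF.
    assert (HV : SZ N (fun k => (Rpower (Lambda k) (m - rho) * Cmod (f k)) ^ 2)
                 <= eps * SZ N g + D * SZ N h).
    { rewrite <- !SZ_scal, <- SZ_plus. apply SZ_le; intros k.
      rewrite Rpow_mult_distr, <- Rpower_double.
      replace (2 * (m - rho)) with (2 * m - 2 * rho) by ring.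
      unfold g. rewrite <- Rmult_assoc. fold (h k). rewrite <- Rmult_plus_distr_r.
      apply Rmult_le_compat_r; auto. }
    apply (Rmult_le_compat_l K) in HV; auto.
    pose proof (SZ_nonneg N h Hh) as H1. pose proof (SZ_nonneg N g Hg) as H2.
    assert (K * eps * SZ N g <= A / 2 * SZ N g) by (apply Rmult_le_compat_r; auto).
    lra. }
  apply (is_lim_seq_le _ _ (A / 2 * sumZ g - (K * D + 1) * sumZ h)
           (Re (l2_pairing (T_op sigma f) f)) Hfin).
  - apply is_lim_seq_minus'; apply (is_lim_seq_scal_l _ _ (Finite _)), sumZ_lim; auto.
  - apply (pairing_lim _ _ _ _ _ _ HW HS Hf).
Qed.
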